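(* Let $\pi':X'\to X$ be the normalization map of an irreducible real algebraic curve $X$. Then the integral closure $\mathcal K^0(\operatorname{Cent}X)'$ of $\mathcal K^0(\operatorname{Cent}X)$ in $\mathcal K(X)$ coincides with the ring $\mathcal O(X')$ of regular functions on the normalization $X'$ of $X$.
   Context: A real algebraic set $X\subset\mathbb R^n$ is the set of common zeros in $\mathbb R^n$ of some polynomials; $\mathcal P(X)=\mathbb R[x_1,\dots,x_n]/\mathcal I(X)$, where $\mathcal I(X)$ is the ideal of polynomials vanishing on $X$. An irreducible real algebraic curve is an irreducible real algebraic set of dimension one. $\mathcal O(X)=\mathcal S(X)^{-1}\mathcal P(X)$ with $\mathcal S(X)$ the set of $f\in\mathcal P(X)$ with no zero on $X$. For $X$ irreducible, $\mathcal K(X)$ is the fraction field of $\mathcal P(X)$. The normalization $X'$ is the real algebraic set whose ring $\mathcal P(X')$ of polynomial functions is the integral closure of $\mathcal P(X)$ in $\mathcal K(X)$, and $\pi':X'\to X$ is the polynomial map induced by $\mathcal P(X)\subset\mathcal P(X')$; one has $\mathcal O(X')\subset\mathcal K(X')=\mathcal K(X)$. The central locus $\operatorname{Cent}X$ is the Euclidean closure in $X$ of the set $X_{reg}$ of non-singular points of $X$ (points $x$ where the localization of $\mathcal P(X)$ at the maximal ideal of functions vanishing at $x$ is a regular local ring). $\mathcal K^0(\operatorname{Cent}X)$ is the ring of functions $f:\operatorname{Cent}X\to\mathbb R$, continuous for the Euclidean topology, that are rational on $X$: there are a Zariski-dense Zariski-open subset $U\subset X$ and polynomials $p,q$ with $q$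 nowhere zero on $U$ and $f=p/q$ on $U\cap\operatorname{Cent}X$. Sending $f$ to the class of $p/q$ gives an injection $\mathcal K^0(\operatorname{Cent}X)\hookrightarrow\mathcal K(X)$, regarded as an inclusion. *)

(* Defs.v *)
From HB Require Import structures.
From mathcomp Require Import all_boot all_order all_algebra.
From mathcomp Require Import all_classical all_reals all_analysis.
From mathcomp.multinomials Require mpoly.
Import -(notations) mpoly.

Set Implicit Arguments.
Unset Strict Implicit.
Unset Printing Implicit Defensive.

Import Order.TTheory GRing.Theory Num.Theory.
Import numFieldNormedType.Exports.

Local Open Scope classical_set_scope.
Local Open Scope ring_scope.
Local Open Scope quotient_scope.

Local Notation frac := (@FracField.tofrac _).

Section CommutativeAlgebra.
Variable A : comNzRingType.
Implicit Types I P : {pred A}.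

(* [idealr_closed] already requires [1 \notin I]. *)
Definition prime_ideal P := idealr_closed P /\ prime_idealr_closed P.

Definition maximal_ideal I :=
  idealr_closed I /\
  forall J : {pred A}, idealr_closed J -> {subset I <= J} -> {subset J <= I}.

Definition generated_by I d (g : 'I_d -> A) :=
  forall a, a \in I <-> exists c : 'I_d -> A, a = \sum_(i < d) c i * g i.

(* The unit ideal, which [idealr_closed] excludes, is generated by 1. *)
Definition noetherian :=
  forall I, idealr_closed I -> exists d (g : 'I_d -> A), generated_by I g.

Definition prime_chain d (P : 'I_d.+1 -> {pred A}) :=
  (forall i, prime_ideal (P i)) /\
  (forall i j : 'I_d.+1, (i < j)%N ->
     {subset P i <= P j} /\ ~ {subset P j <= P i}).

Definition krull_dim_eq d :=
  (exists P : 'I_d.+1 -> {pred A}, prime_chain P) /\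
  (forall e (P : 'I_e.+1 -> {pred A}), prime_chain P -> (e <= d)%N).

Definition regular_local_ring :=
  noetherian /\
  exists I, [/\ maximal_ideal I,
    forall J, maximal_ideal J -> J =i I &
    exists d (g : 'I_d -> A), krull_dim_eq d /\ generated_by I g].

End CommutativeAlgebra.

Section Localization.
Variable A : idomainType.

(* S^-1 A inside the fraction field; S is meant to be multiplicative with
   0 \notin S. *)
Definition localization (S : {pred A}) : {pred {fraction A}} :=
  fun z => `[< exists a s, s \in S /\ z = frac a / frac s >].

Lemma localizationP (S : {pred A}) z :
  reflect (exists a s, s \in S /\ z = frac a / frac s) (z \in localization S).
Proof. exact: asboolP. Qed.

Lemma tofrac_sub_div (a b s t : A) : frac s != 0 -> frac t != 0 ->
  frac a / frac s - frac b / frac t = frac (a * t - b * s) / frac (s * t).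
Proof.
by move=> s0 t0; rewrite -mulNr addf_div // tofracB !tofracM mulNr.
Qed.

Lemma tofrac_mul_div (a b s t : A) :
  frac a / frac s * (frac b / frac t) = frac (a * b) / frac (s * t).
Proof. by rewrite mulf_div !tofracM. Qed.

Lemma localization_subring (S : {pred A}) :
  GRing.mulr_closed S -> 0 \notin S -> subring_closed (localization S).
Proof.
move=> [S1 SM] S0.
have nz s : s \in S -> frac s != 0.
  by move=> Ss; rewrite tofrac_eq0; apply: contraNneq S0 => <-.
split.
- by apply/localizationP; exists 1, 1; rewrite S1 !tofrac1 divr1.
- move=> _ _ /localizationP[a [s [Ss ->]]] /localizationP[b [t [St ->]]].
  apply/localizationP; exists (a * t - b * s), (s * t); split; first exact: SM.
  by rewrite tofrac_sub_div ?nz.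
- move=> _ _ /localizationP[a [s [Ss ->]]] /localizationP[b [t [St ->]]].
  apply/localizationP; exists (a * b), (s * t); split; first exact: SM.
  exact: tofrac_mul_div.
Qed.

End Localization.

Local Notation "{ 'mpoly' R [ n ] }" := (mpoly n R) : type_scope.

Section AlgebraicSets.
Variables (R : realType) (n : nat).

Definition ev (p : {mpoly R[n]}) (x : 'rV[R]_n) : R :=
  meval (fun i => x ord0 i) p.

Definition algebraic (X : set 'rV[R]_n) :=
  exists S : set {mpoly R[n]}, X = [set x | forall p, S p -> ev p x = 0].

Definition irreducible (X : set 'rV[R]_n) :=
  X !=set0 /\
  forall Y Z, algebraic Y -> algebraic Z -> X = Y `|` Z -> X = Y \/ X = Z.

Record irr_algset := IrrAlgSet {
  irr_set :> set 'rV[R]_n;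
  irr_algebraic : algebraic irr_set;
  irr_irreducible : irreducible irr_set }.

Definition vanishing (X : irr_algset) : {pred {mpoly R[n]}} :=
  fun p => `[< forall x, irr_set X x -> ev p x = 0 >].

Lemma vanishingP (X : irr_algset) p :
  reflect (forall x, irr_set X x -> ev p x = 0) (p \in vanishing X).
Proof. exact: asboolP. Qed.

Lemma vanishing_idealr (X : irr_algset) : idealr_closed (vanishing X).
Proof.
split.
- by apply/vanishingP => x _; rewrite /ev meval0.
- apply/vanishingP => h; have [x Xx] := (irr_irreducible X).1.
  by have /eqP := h x Xx; rewrite /ev meval1 oner_eq0.
- move=> a p q /vanishingP Ip /vanishingP Iq; apply/vanishingP => x Xx.
  rewrite /ev mevalD mevalM.
  by rewrite [X in _ * X](Ip x Xx) [X in _ + X](Iq x Xx) mulr0 addr0.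
Qed.

Lemma algebraic_cut (X : set 'rV[R]_n) p :
  algebraic X -> algebraic (X `&` [set x | ev p x = 0]).
Proof.
move=> [S ->]; exists (S `|` [set p]); apply/seteqP; split=> x /=.
  by move=> [h hp] q [/h//|->].
by move=> h; split=> [q Sq|]; apply: h; [left|right].
Qed.

Lemma vanishing_prime (X : irr_algset) : prime_idealr_closed (vanishing X).
Proof.
move=> p q /vanishingP Ipq.
have Xpq : (X : set _) =
    (X `&` [set x | ev p x = 0]) `|` (X `&` [set x | ev q x = 0]).
  apply/seteqP; split=> [x Xx|x [] []//].
  have /eqP := Ipq x Xx; rewrite /ev mevalM mulf_eq0.
  by case/orP => /eqP; [left|right].
have aX := irr_algebraic X.
have [e|e] := (irr_irreducible X).2 _ _ (algebraic_cut p aX)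
  (algebraic_cut q aX) Xpq; apply/orP; [left|right]; apply/vanishingP => x.
  by rewrite {1}e => -[].
by rewrite {1}e => -[].
Qed.

HB.instance Definition _ X :=
  isIdealr.Build {mpoly R[n]} (vanishing X) (vanishing_idealr X).
HB.instance Definition _ X :=
  isPrimeIdealrClosed.Build {mpoly R[n]} (vanishing X)
    (@vanishing_prime X).

Definition polyfun (X : irr_algset) := {ideal_quot (vanishing X)}.
HB.instance Definition _ X := GRing.ComNzRing.on (polyfun X).

Definition polyclass (X : irr_algset) (p : {mpoly R[n]}) : polyfun X :=
  \pi_(polyfun X) p.

(* Meaningful for [x] in [X] only, see [peval_polyclass]. *)
Definition peval (X : irr_algset) (f : polyfun X) (x : 'rV[R]_n) : R :=
  ev (repr f) x.

Section PolyFun.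
Variable X : irr_algset.
Implicit Types (f g : polyfun X) (p q : {mpoly R[n]}).

Lemma polyclass_eq p q :
  (polyclass X p = polyclass X q) <->
  (forall x, irr_set X x -> ev p x = ev q x).
Proof.
split=> [/eqP|h]; last first.
  apply/eqP; rewrite /polyclass piE Quotient.equivE; apply/vanishingP => x Xx.
  by rewrite /ev mevalB [X in X - _](h x Xx) subrr.
rewrite /polyclass piE Quotient.equivE => /vanishingP h x Xx.
by apply/eqP; rewrite -subr_eq0; have := h x Xx; rewrite /ev mevalB => ->.
Qed.

Lemma polyclass0 : polyclass X 0 = 0. Proof. by rewrite /polyclass rmorph0. Qed.
Lemma polyclass1 : polyclass X 1 = 1. Proof. by rewrite /polyclass rmorph1. Qed.
Lemma polyclassB p q : polyclass X (p - q) = polyclass X p - polyclass X q.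
Proof. by rewrite /polyclass rmorphB. Qed.
Lemma polyclassM p q : polyclass X (p * q) = polyclass X p * polyclass X q.
Proof. by rewrite /polyclass rmorphM. Qed.
Lemma polyclass_repr f : polyclass X (repr f) = f. Proof. exact: reprK. Qed.

Lemma peval_polyclass p x : irr_set X x -> peval (polyclass X p) x = ev p x.
Proof.
by move=> Xx; apply: (polyclass_eq _ _).1 Xx; rewrite polyclass_repr.
Qed.

Lemma peval1 x : irr_set X x -> peval (1 : polyfun X) x = 1.
Proof.
by move=> Xx; rewrite -polyclass1 peval_polyclass // /ev meval1.
Qed.

Lemma pevalM f g x : irr_set X x -> peval (f * g) x = peval f x * peval g x.
Proof.
move=> Xx; rewrite -{1}[f]polyclass_repr -{1}[g]polyclass_repr -polyclassM.
by rewrite peval_polyclass // /ev mevalM.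
Qed.

Definition polyfun_unit : {pred polyfun X} :=
  fun f => `[< exists g, g * f = 1 >].
Definition polyfun_inv f : polyfun X :=
  if pselect (exists g, g * f = 1) is left e then sval (cid e) else f.

Fact polyfun_mulVx : {in polyfun_unit, left_inverse 1 polyfun_inv *%R}.
Proof.
move=> f /asboolP uf; rewrite /polyfun_inv.
by case: pselect => // e; case: cid.
Qed.

Fact polyfun_unitPl f g : g * f = 1 -> polyfun_unit f.
Proof. by move=> gf; apply/asboolP; exists g. Qed.

Fact polyfun_inv_out : {in [predC polyfun_unit], polyfun_inv =1 id}.
Proof.
move=> f; rewrite inE /= => /asboolPn uf; rewrite /polyfun_inv.
by case: pselect.
Qed.

HB.instance Definition _ := GRing.ComNzRing_hasMulInverse.Build (polyfun X)
  polyfun_mulVx polyfun_unitPl polyfun_inv_out.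

Fact polyfun_integral : GRing.integral_domain_axiom (polyfun X).
Proof. exact: (@Quotient.rquot_IdomainAxiom _ (vanishing X)). Qed.

HB.instance Definition _ :=
  GRing.ComUnitRing_isIntegral.Build (polyfun X) polyfun_integral.

End PolyFun.

Local Notation ratfun X := {fraction (polyfun X)}.

Definition nowhere_zero (X : irr_algset) : {pred polyfun X} :=
  fun f => `[< forall x, irr_set X x -> peval f x <> 0 >].

Definition regular_functions (X : irr_algset) : {pred ratfun X} :=
  localization (@nowhere_zero X).

Definition nonzero_at (X : irr_algset) (x : X) : {pred polyfun X} :=
  fun f => peval f (\val x) != 0.

Definition regular_at (X : irr_algset) (x : X) : {pred ratfun X} :=
  localization (nonzero_at x).

Fact regular_at_subring (X : irr_algset) (x : X) :
  subring_closed (regular_at x).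
Proof.
have Xx : irr_set X (\val x) by apply: set_mem; exact: (valP x).
apply: localization_subring; last first.
  rewrite unfold_in /nonzero_at negbK -polyclass0 peval_polyclass //.
  by rewrite /ev meval0.
split=> [|f g]; first by rewrite unfold_in peval1 // oner_eq0.
by rewrite !unfold_in pevalM // => fx gx; rewrite mulf_neq0.
Qed.

HB.instance Definition _ (X : irr_algset) (x : X) :=
  GRing.isSubringClosed.Build (ratfun X) (regular_at x) (regular_at_subring x).

Definition local_ring (X : irr_algset) (x : X) :=
  {z : ratfun X | z \in regular_at x}.

HB.instance Definition _ (X : irr_algset) (x : X) :=
  [isSub of local_ring x for @sval _ _].
HB.instance Definition _ (X : irr_algset) (x : X) :=
  [Choice of local_ring x by <:].
HB.instance Definition _ (X : irr_algset) (x : X) :=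
  [SubChoice_isSubComNzRing of local_ring x by <:].

Definition nonsingular (X : irr_algset) : set 'rV[R]_n :=
  [set \val x | x in [set x : X | regular_local_ring (local_ring x)]].

Definition Cent (X : irr_algset) : set 'rV[R]_n :=
  X `&` closure (nonsingular X).

Definition zariski_open (X U : set 'rV[R]_n) :=
  exists2 Z, algebraic Z & U = X `\` Z.

Definition zariski_dense (X U : set 'rV[R]_n) :=
  forall Z, algebraic Z -> U `<=` Z -> X `<=` Z.

Definition represents (X : irr_algset) (f : 'rV[R]_n -> R)
    (p q : {mpoly R[n]}) :=
  exists U, [/\ zariski_open X U, zariski_dense X U,
    forall x, U x -> ev q x <> 0 &
    forall x, U x -> Cent X x -> f x = ev p x / ev q x].

(* The image of K^0(Cent X) in K(X). Only the restriction of [f] to [Cent X]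
   matters. *)
Definition cont_rational (X : irr_algset) : {pred ratfun X} := fun z =>
  `[< exists f p q, [/\ {within Cent X, continuous f}, represents X f p q &
        z = frac (polyclass X p) / frac (polyclass X q)] >].

Lemma algebraic_setU (Y Z : set 'rV[R]_n) :
  algebraic Y -> algebraic Z -> algebraic (Y `|` Z).
Proof.
move=> [S ->] [T ->].
exists [set p | exists q r, [/\ S q, T r & p = q * r]].
apply/seteqP; split=> x /=.
  move=> h _ [q [r [Sq Tr ->]]]; rewrite /ev mevalM.
  by case: h => h; [rewrite [X in X * _](h q Sq) mul0r
                  | rewrite [X in _ * X](h r Tr) mulr0].
move=> h; have [hq|/existsNP[q /not_implyP[Sq hq]]] :=
  pselect (forall q, S q -> ev q x = 0); [by left | right => r Tr].
have /eqP := h _ (ex_intro _ q (ex_intro _ r (And3 Sq Tr erefl))).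
by rewrite /ev mevalM mulf_eq0 => /orP[/eqP /hq|/eqP].
Qed.

Lemma zariski_openI (X U V : set 'rV[R]_n) :
  zariski_open X U -> zariski_open X V -> zariski_open X (U `&` V).
Proof.
move=> [Y aY ->] [Z aZ ->]; exists (Y `|` Z); first exact: algebraic_setU.
by rewrite setDUr.
Qed.

Lemma zariski_denseI (X U V : set 'rV[R]_n) :
  zariski_open X U -> zariski_open X V -> zariski_dense X U ->
  zariski_dense X V -> zariski_dense X (U `&` V).
Proof.
move=> [Y aY ->] [Z aZ ->] dU dV W aW sW.
apply: dV => // x [Xx nZx]; have := dU (Z `|` W) (algebraic_setU aZ aW).
case/(_ _ x Xx) => // y [Xy nYy]; have [Zy|nZy] := pselect (Z y); first by left.
by right; apply: sW.
Qed.

Lemma represents_den_neq0 (X : irr_algset) f p q :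
  represents X f p q -> frac (polyclass X q) != 0.
Proof.
move=> [U [[Z _ ->] dU nq _]]; rewrite tofrac_eq0; apply/eqP.
rewrite -polyclass0 => /polyclass_eq q0; have [x Xx] := (irr_irreducible X).1.
have a0 : algebraic (set0 : set 'rV[R]_n).
  exists [set 1]; apply/seteqP; split=> // y /(_ _ erefl)/eqP.
  by rewrite /ev meval1 oner_eq0.
apply: (dU _ a0 _ x Xx) => y Uy; apply: (nq y Uy).
by case: Uy => Xy _; rewrite q0 // /ev meval0.
Qed.

Fact cont_rational_subring (X : irr_algset) : subring_closed (@cont_rational X).
Proof.
split.
- apply/asboolP; exists (cst 1), 1, 1; split; first exact: cst_continuous.
    exists X; split=> //.
    + exists set0; last by rewrite setD0.
      exists [set 1]; apply/seteqP; split=> // y /(_ _ erefl)/eqP.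
      by rewrite /ev meval1 oner_eq0.
    + by move=> x _; rewrite /ev meval1; apply/eqP; exact: oner_neq0.
    + by move=> x _ _; rewrite /ev meval1 divr1.
  by rewrite polyclass1 tofrac1 divr1.
- move=> _ _ /asboolP[f [p [q [cf rf ->]]]] /asboolP[g [r [s [cg rg ->]]]].
  have [nq ns] := (represents_den_neq0 rf, represents_den_neq0 rg).
  apply/asboolP; exists (f - g), (p * s - r * q), (q * s); split.
  + move=> x; apply: (@continuousB R R (subspace (Cent X)));
      [exact: cf|exact: cg].
  + move: rf rg => [U [oU dU nqU fU]] [V [oV dV nsV gV]].
    exists (U `&` V); split.
    * exact: zariski_openI.
    * exact: zariski_denseI.
    * move=> x [Ux Vx]; rewrite /ev mevalM; apply/eqP.
      by apply: mulf_neq0; apply/eqP; [exact: nqU|exact: nsV].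
    * move=> x [Ux Vx] Cx; rewrite /= -[LHS]/(f x - g x) fU // gV //.
      rewrite -mulNr addf_div; [|exact/eqP/nqU|exact/eqP/nsV].
      by rewrite /ev mevalB !mevalM mulNr.
  + by rewrite polyclassB !polyclassM (tofrac_sub_div _ _ nq ns).
- move=> _ _ /asboolP[f [p [q [cf rf ->]]]] /asboolP[g [r [s [cg rg ->]]]].
  apply/asboolP; exists (f \* g), (p * r), (q * s); split.
  + move=> x; apply: (@continuousM R (subspace (Cent X)));
      [exact: cf|exact: cg].
  + move: rf rg => [U [oU dU nqU fU]] [V [oV dV nsV gV]].
    exists (U `&` V); split.
    * exact: zariski_openI.
    * exact: zariski_denseI.
    * move=> x [Ux Vx]; rewrite /ev mevalM; apply/eqP.
      by apply: mulf_neq0; apply/eqP; [exact: nqU|exact: nsV].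
    * by move=> x [Ux Vx] Cx; rewrite /= fU // gV // mulf_div /ev !mevalM.
  + by rewrite !polyclassM; exact: tofrac_mul_div.
Qed.

HB.instance Definition _ X :=
  GRing.isSubringClosed.Build (ratfun X) (@cont_rational X)
    (cont_rational_subring X).

Definition K0Cent (X : irr_algset) := {z : ratfun X | z \in @cont_rational X}.

HB.instance Definition _ X := [isSub of K0Cent X for @sval _ _].
HB.instance Definition _ X := [Choice of K0Cent X by <:].
HB.instance Definition _ X := [SubChoice_isSubComNzRing of K0Cent X by <:].

(* The dimension of X is the Krull dimension of P(X). *)
Definition is_curve (X : irr_algset) := krull_dim_eq (polyfun X) 1.

End AlgebraicSets.

Arguments nowhere_zero {R n} X _.
Arguments regular_functions {R n} X _.
Arguments cont_rational {R n} X _.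

Notation ratfun X := {fraction (polyfun X)}.

Section Normalization.
Variables (R : realType) (m n : nat).

Definition polymap (pi' : n.-tuple {mpoly R[m]}) (y : 'rV[R]_m) : 'rV[R]_n :=
  \row_i ev (tnth pi' i) y.

(* [iota] is the identification K(X') = K(X) : it inverts pullback along [pi'],
   so that the inclusion P(X) -> P(X') is the one induced by [pi'], and it
   carries P(X') onto the integral closure of P(X) in K(X). It is surjective,
   since P(X) lies in its image, and it is determined by [pi']. Irreducibility
   of X' is no restriction: its ring P(X') embeds in a field. *)
Definition is_normalization (X' : irr_algset R m) (X : irr_algset R n)
    (pi' : n.-tuple {mpoly R[m]}) (iota : {rmorphism ratfun X' -> ratfun X}) :=
  [/\ forall y, irr_set X' y -> irr_set X (polymap pi' y),
      forall p : {mpoly R[n]},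
        iota (frac (polyclass X' (comp_mpoly pi' p))) = frac (polyclass X p) &
      forall z : ratfun X,
        integralOver (@FracField.tofrac (polyfun X)) z <->
        exists f : polyfun X', z = iota (frac f)].

End Normalization.

(* Main.v *)
(* The ring of the normalization is integrally closed of dimension one, so its
   local ring at each real point y is a valuation ring, whose uniformizer can be
   taken among the coordinates centred at y. Solving the equations of X' by
   successive approximation in that coordinate shows that y is not isolated in
   X'; points of X' close to y and off the zeros of a common denominator c of
   the coordinates of X' lie over non-singular points of X. Hence a function
   continuous on Cent X has no pole on X', and neither has a rational function
   integral over such functions.

   Conversely, for g regular on X', only finitely many points of X' lie over the
   zeros of c. If Q is a monic real polynomial vanishing at the values of g at
   these points, then Q(g), a function on X off the zeros of c, extends by zero
   to a continuous function on X, because X' -> X is proper. So g is integral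
   over K^0(Cent X). *)

Require Import Defs.
From HB Require Import structures.
From mathcomp Require Import all_boot all_order all_algebra.
From mathcomp Require Import all_classical all_reals all_analysis.
From mathcomp Require Import ring lra.
From mathcomp.multinomials Require mpoly.
Import -(notations) mpoly.

Set Implicit Arguments.
Unset Strict Implicit.
Unset Printing Implicit Defensive.

Local Open Scope classical_set_scope.
Local Open Scope ring_scope.

Import Order.TTheory GRing.Theory Num.Theory.
Import numFieldNormedType.Exports.

Local Notation frac := (@FracField.tofrac _).

(** * Noetherian rings and prime ideals *)

(** The obstacle is a real one. A curve may have isolated points, such as the origin of y^2 = x^2 (x
    - 1), and continuity at such a place could not exclude a pole. No point of X' may lie over it,
    so each point of X' has to be a limit of other real points of X', which algebra alone does not
    give. In the converse direction g itself need not descend to a continuous function: it may take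
    two values over the same node of X. The polynomial Q kills all these values at once, so that
    Q(g) tends to zero along every branch. The same extension by zero covers the zeros of c over
    which X' has no real point at all. *)

Section Ideals.
Variable A : comNzRingType.
Implicit Types (I J P : set A) (a b x y : A).

(** Unlike [idealr_closed], this admits the unit ideal, so that sums of ideals are ideals without
    any condition. *)
Definition ideal_set I := I 0 /\ forall a x y, I x -> I y -> I (a * x + y).

Lemma idealD I x y : ideal_set I -> I x -> I y -> I (x + y).
Proof. by move=> [_ h] Ix Iy; rewrite -[x]mul1r; apply: h. Qed.

Lemma idealMl I a x : ideal_set I -> I x -> I (a * x).
Proof. by move=> [I0 h] Ix; rewrite -[_ * _]addr0; apply: h. Qed.

Lemma idealB I x y : ideal_set I -> I x -> I y -> I (x - y).
Proof.
by move=> idI Ix Iy; apply: idealD => //; rewrite -mulN1r; apply: idealMl.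
Qed.

Lemma ideal_sum I (T : Type) (r : seq T) (Q : pred T) (F : T -> A) :
  ideal_set I -> (forall i, Q i -> I (F i)) -> I (\sum_(i <- r | Q i) F i).
Proof.
move=> idI IF; elim/big_rec: _ => [|i x Qi Ix]; first by case: idI.
by apply: idealD => //; apply: IF.
Qed.

(* Finite generation, phrased without linear combinations: the least ideal
   containing [s]. *)
Definition noetherian_ring := forall I, ideal_set I -> exists s : seq A,
  (forall x, x \in s -> I x) /\
  forall J, ideal_set J -> (forall x, x \in s -> J x) -> I `<=` J.

Lemma span_ideal (s : seq A) :
  ideal_set [set a | exists c : 'I_(size s) -> A, a = \sum_i c i * s`_i].
Proof.
split; first by exists (fun=> 0); rewrite big1 // => i _; rewrite mul0r.
move=> a _ _ [c ->] [d ->]; exists (fun i => a * c i + d i).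
by rewrite mulr_sumr -big_split; apply: eq_bigr => i _; rewrite /= mulrDl mulrA.
Qed.

Lemma noetherian_span I : noetherian_ring -> ideal_set I -> exists s : seq A,
  (forall x, x \in s -> I x) /\
  forall a, I a -> exists c : 'I_(size s) -> A, a = \sum_i c i * s`_i.
Proof.
move=> nA /nA[s [sI sJ]]; exists s; split=> // a.
apply: (sJ [set a | _]); first exact: span_ideal.
move=> x xs; have lt_xs : (index x s < size s)%N by rewrite index_mem.
exists (fun i => (i == Ordinal lt_xs)%:R).
rewrite (bigD1 (Ordinal lt_xs)) //= eqxx mul1r nth_index // big1 ?addr0 //.
by move=> i /negPf ->; rewrite mul0r.
Qed.

Lemma noetherian_maximal (F : set (set A)) I0 :
  noetherian_ring -> F `<=` ideal_set -> F I0 ->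
  exists2 I, F I & forall J, F J -> I `<=` J -> J `<=` I.
Proof.
(* [Zorn_bigcup] also asks about the empty chain, whose union is empty; hence [set0] is added to
   [F]. The union of a nonempty chain is one of its members, namely one that contains the finitely
   many generators of the union. *)
move=> nA Fid FI0; have [|M [FM maxM]] := @Zorn_bigcup A (F `|` [set set0]).
  move=> G sGF totG; have [[I1 [GI1 FI1]]|noI] := pselect (exists I, G I /\ F I).
  - left; set U := \bigcup_(X in G) X.
    have idU : ideal_set U.
      split; first by exists I1 => //; case: (Fid _ FI1).
      move=> a x y [J GJ Jx] [K GK Ky].
      have [FJ FK] : F J /\ F K.
        split; first by have [//|J0] := sGF _ GJ; rewrite J0 in Jx.
        by have [//|K0] := sGF _ GK; rewrite K0 in Ky.
      have [sJK|sKJ] := totG _ _ GJ GK.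
        by exists K => //; apply: (Fid _ FK).2 => //; apply: sJK.
      by exists J => //; apply: (Fid _ FJ).2 => //; apply: sKJ.
    have [s [sU sJ]] := nA _ idU.
    have [J [GJ FJ sJ']] : exists J, [/\ G J, F J & forall x, x \in s -> J x].
      elim: s sU {sJ} => [|x s IHs] sU; first by exists I1.
      have [|J [GJ FJ sJ]] := IHs.
        by move=> z zs; apply: sU; rewrite inE zs orbT.
      have [K GK Kx] : U x by apply: sU; rewrite mem_head.
      have FK : F K by have [//|K0] := sGF _ GK; rewrite K0 in Kx.
      have [sJK|sKJ] := totG _ _ GJ GK.
        by exists K; split=> // z; rewrite inE => /predU1P[->//|/sJ/sJK].
      by exists J; split=> // z; rewrite inE => /predU1P[->|/sJ//]; apply: sKJ.
    suff -> : U = J by [].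
    apply/seteqP; split; first by apply: sJ => //; apply: Fid.
    by move=> z Jz; exists J.
  - right; apply/seteqP; split=> // x [J GJ Jx].
    have [FJ|J0] := sGF _ GJ; first by case: noI; exists J.
    by rewrite J0 in Jx.
have FM' : F M.
  case: FM => // M0; case: (maxM I0); last by left.
  by rewrite M0; split=> // sI0; apply: sI0 (Fid _ FI0).1.
exists M => // J FJ sMJ; apply: contrapT => nJM.
by apply: (maxM J); [split | left].
Qed.

Definition prime_set P :=
  [/\ ideal_set P, ~ P 1 & forall x y, P (x * y) -> P x \/ P y].

Definition ideal_add I x := [set z | exists a b, I b /\ z = a * x + b].

Lemma ideal_addP I x : ideal_set I -> ideal_set (ideal_add I x).
Proof.
move=> idI; split; first by exists 0, 0; split; [case: idI | rewrite mul0r addr0].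
move=> c _ _ [a [b [Ib ->]]] [a' [b' [Ib' ->]]].
exists (c * a + a'), (c * b + b'); split; first by apply idI.2.
by rewrite mulrDr mulrDl mulrA addrACA.
Qed.

Lemma ideal_add_sub I x : I `<=` ideal_add I x.
Proof. by move=> z Iz; exists 0, z; rewrite mul0r add0r. Qed.

Lemma ideal_add_mem I x : ideal_set I -> ideal_add I x x.
Proof. by move=> [I0 _]; exists 1, 0; rewrite mul1r addr0. Qed.

(* An ideal maximal among those that contain [I] and avoid [S] is prime. *)
Lemma prime_avoiding (S : set A) I : noetherian_ring -> ideal_set I ->
  S 1 -> (forall x y, S x -> S y -> S (x * y)) -> (forall x, I x -> ~ S x) ->
  exists P, [/\ prime_set P, I `<=` P & forall x, P x -> ~ S x].
Proof.
move=> nA idI S1 SM IS.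
pose F J := [/\ ideal_set J, I `<=` J & forall x, J x -> ~ S x].
have [| |P [idP sIP PS] maxP] := @noetherian_maximal F I nA.
- by move=> J [].
- by split.
exists P; split=> //; split=> // [/PS//|x y Pxy].
apply: contrapT => /not_orP[nPx nPy].
have meet z : ~ P z -> exists a b, P b /\ S (a * z + b).
  move=> nPz; apply: contrapT => nS; apply: nPz.
  apply: (maxP (ideal_add P z)); last exact: ideal_add_mem.
    split; first exact: ideal_addP.
    - by apply: subset_trans sIP _; apply: ideal_add_sub.
    - by move=> _ [a [b [Pb ->]]] Sab; apply: nS; exists a, b.
  exact: ideal_add_sub.
have [a [b [Pb Sx]]] := meet x nPx; have [c [d [Pd Sy]]] := meet y nPy.
apply: PS (SM _ _ Sx Sy); rewrite mulrDl; apply: idealD => //; last first.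
  by rewrite mulrC; apply: idealMl.
rewrite mulrDr; apply: idealD => //; last exact: idealMl.
by rewrite mulrACA; apply: idealMl.
Qed.

(** Krull dimension at most one, for a domain: there 0 is the first term of every maximal chain, so
    a nonzero prime lies in no larger one. *)
Definition dim_le1 :=
  forall P Q x, prime_set P -> prime_set Q -> P x -> P `<=` Q -> Q `<=` P \/ x = 0.

End Ideals.

Section NoetherianTransfer.
Variables (A B : comNzRingType) (f : {rmorphism A -> B}).

(* Covers surjections ([b = b' = 1]) and localizations. *)
Lemma noetherian_transfer : noetherian_ring A ->
  (forall z : B, exists a b b', z = b * f a /\ f a = b' * z) ->
  noetherian_ring B.
Proof.
move=> nA fB I idI.
have idf J : ideal_set J -> ideal_set (f @^-1` J).
  move=> [J0 JD]; split; first by rewrite /= rmorph0.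
  by move=> a x y /= Jx Jy; rewrite rmorphD rmorphM; apply: JD.
have [s [sI sJ]] := nA _ (idf I idI).
exists (map f s); split=> [x /mapP[a /sI fa ->]//|J idJ fsJ z Iz].
have [a [b [b' [zE faE]]]] := fB z; rewrite zE; apply: idealMl => //.
apply: (sJ _ (idf J idJ)) => [x xs|]; first by apply: fsJ; apply: map_f.
by rewrite /= faE; apply: idealMl.
Qed.

End NoetherianTransfer.

Lemma noetherian_field (F : fieldType) : noetherian_ring F.
Proof.
move=> I idI; have [[x Ix x0]|noI] := pselect (exists2 x, I x & x != 0).
  exists [:: x]; split=> [y|J idJ sJ y _]; first by rewrite inE => /eqP ->.
  by rewrite -(mulfVK x0 y); apply: idealMl => //; apply: sJ; rewrite inE.
exists [::]; split=> // J idJ _ x Ix; have [->|x0] := eqVneq x 0.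
  by case: idJ.
by case: noI; exists x.
Qed.

Section HilbertBasis.
Variable A : comNzRingType.
Implicit Types (I J : set {poly A}) (p q : {poly A}).

(** The size is only bounded, so that 0 and sums with cancelling top coefficients are included. *)
Definition lead_ideal I d : set A :=
  [set c | exists p, [/\ I p, (size p <= d.+1)%N & p`_d = c]].

Lemma lead_ideal_ideal I d : ideal_set I -> ideal_set (lead_ideal I d).
Proof.
move=> idI; split; first by exists 0; rewrite size_poly0 coef0; case: idI.
move=> a _ _ [p [Ip sp <-]] [q [Iq sq <-]]; exists (a%:P * p + q); split.
- by apply idI.2.
- rewrite (leq_trans (size_polyD _ _)) // geq_max sq andbT mul_polyC.
  exact: leq_trans (size_scale_leq _ _) sp.
- by rewrite coefD coefCM.
Qed.

Lemma lead_idealS I d e : (d <= e)%N -> ideal_set I ->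
  lead_ideal I d `<=` lead_ideal I e.
Proof.
move=> de idI _ [p [Ip sp <-]]; exists ('X^(e - d) * p); split.
- exact: idealMl.
- rewrite (leq_trans (size_polyMleq _ _)) // size_polyXn addSn /=.
  by rewrite -(subnK de) -addnS subnK // leq_add2l.
- by rewrite coefXnM ltnNge leq_subr /= subKn.
Qed.

(** Hilbert's basis theorem: the lead ideals grow with the degree and are stationary from some [N]
    on, so finitely many polynomials have leading coefficients generating all of them. *)
Lemma noetherian_poly : noetherian_ring A -> noetherian_ring {poly A}.
Proof.
move=> nA I idI; pose L := \bigcup_d lead_ideal I d.
have idL : ideal_set L.
  split; first by exists 0%N => //; case: (lead_ideal_ideal 0 idI).
  move=> a x y [d _ Lx] [e _ Ly]; exists (maxn d e) => //.
  apply: (lead_ideal_ideal _ idI).2.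
    exact: lead_idealS (leq_maxl _ _) idI _ Lx.
  exact: lead_idealS (leq_maxr _ _) idI _ Ly.
have [s [sL sJ]] := nA _ idL.
have [N LN] : exists N, L `<=` lead_ideal I N.
  suff [N sN] : exists N, forall x, x \in s -> lead_ideal I N x.
    by exists N; apply: sJ => //; apply: lead_ideal_ideal.
  elim: s sL {sJ} => [|x s IHs] sL; first by exists 0%N.
  have [|N sN] := IHs; first by move=> z zs; apply: sL; rewrite inE zs orbT.
  have [d _ Lx] := sL x (mem_head _ _); exists (maxn d N) => z.
  rewrite inE => /predU1P[->|/sN Lz].
    exact: lead_idealS (leq_maxl _ _) idI _ Lx.
  exact: lead_idealS (leq_maxr _ _) idI _ Lz.
have lifts d : exists t : seq {poly A},
    (forall p, p \in t -> I p /\ (size p <= d.+1)%N) /\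
    forall J : set A, ideal_set J -> (forall p, p \in t -> J p`_d) ->
      lead_ideal I d `<=` J.
  have [u [uL uJ]] := nA _ (lead_ideal_ideal d idI).
  suff [t [tI tu]] : exists t : seq {poly A},
      (forall p, p \in t -> I p /\ (size p <= d.+1)%N) /\
      forall x, x \in u -> exists2 p, p \in t & p`_d = x.
    exists t; split=> // J idJ tJ; apply: uJ => // x /tu[p pt <-].
    exact: tJ.
  elim: u uL {uJ} => [|x u IHu] uL; first by exists [::].
  have [|t [tI tu]] := IHu; first by move=> z zu; apply: uL; rewrite inE zu orbT.
  have [p [Ip sp px]] := uL x (mem_head _ _); exists (p :: t); split.
    by move=> q; rewrite inE => /predU1P[->//|/tI].
  move=> z; rewrite inE => /predU1P[->|/tu[q qt <-]].
    by exists p; rewrite ?mem_head.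
  by exists q; rewrite // inE qt orbT.
have [T TP] := choice lifts.
exists (flatten [seq T d | d <- iota 0 N.+1]); split.
  by move=> p /flatten_mapP[d _ /(TP d).1[]].
(* Passing to the lead ideals of the intersection makes every leading coefficient of [I] the
   coefficient of some element of [J] of no larger degree; subtracting that element lowers the
   degree. *)
move=> J idJ TJ; have idIJ : ideal_set (I `&` J).
  split; first by split; [case: idI | case: idJ].
  by move=> a x y [Ix Jx] [Iy Jy]; split; [apply idI.2 | apply idJ.2].
have step d : (d <= N)%N -> lead_ideal I d `<=` lead_ideal (I `&` J) d.
  move=> dN; apply: (TP d).2; first exact: lead_ideal_ideal.
  move=> p pT; have [Ip sp] := (TP d).1 p pT; exists p; split=> //; split=> //.
  by apply: TJ; apply/flatten_mapP; exists d; rewrite // mem_iota ltnS.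
have step' d : lead_ideal I d `<=` lead_ideal (I `&` J) d.
  move=> c Lc; have [/step|lt_Nd] := leqP d N; first exact.
  apply: (lead_idealS (ltnW lt_Nd) idIJ); apply: step => //.
  by apply: LN; exists d.
suff main d p : I p -> (size p <= d)%N -> J p by move=> p Ip; apply: main Ip (leqnn _).
elim: d p => [|d IHd] p Ip sp.
  by move: sp; rewrite leqn0 size_poly_eq0 => /eqP ->; case: idJ.
have [q [[Iq Jq] sq qd]] : lead_ideal (I `&` J) d p`_d.
  by apply: step'; exists p.
rewrite -(subrK q p); apply: idealD => //; apply: IHd; first exact: idealB.
apply/leq_sizeP => j; rewrite leq_eqVlt => /predU1P[<-|dj].
  by rewrite coefB qd subrr.
by rewrite coefB !nth_default ?subrr //; [apply: leq_trans sq dj | apply: leq_trans sp dj].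
Qed.

End HilbertBasis.

Lemma mpoly_ring_ind (R : comNzRingType) n (P : mpoly n R -> Prop) :
  (forall c, P (mpolyC n c)) -> (forall i, P (mpolyX R (mnm1 i))) ->
  (forall p q, P p -> P q -> P (p + q)) ->
  (forall p q, P p -> P q -> P (p * q)) -> forall p, P p.
Proof.
move=> PC PX PD PM; apply: mpolyind => [|c m p _ _ Pp]; first by rewrite -mpolyC0.
apply: PD => //; rewrite -mul_mpolyC; apply: (PM) => //.
have P1 : P 1 by rewrite -mpolyC1.
rewrite mpolyXE_id; apply: (big_ind P) => [|x y|i _]; [by []|exact: (PM)|].
elim: (m i) => [|k IHk]; first by rewrite expr0.
by rewrite exprS; apply: PM.
Qed.

Lemma noetherian_mpoly (R : fieldType) n : noetherian_ring (mpoly n R).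
Proof.
have surj (A B : comNzRingType) (f : {rmorphism A -> B}) : noetherian_ring A ->
    (forall z, exists a, z = f a) -> noetherian_ring B.
  move=> nA fs; apply: (noetherian_transfer (f := f)) => // z.
  by have [a ->] := fs z; exists a, 1, 1; rewrite mul1r.
elim: n => [|n IHn].
  apply: (surj _ _ (@mpolyC 0 R)); first exact: noetherian_field.
  elim/mpoly_ring_ind => [c|[]//|p q [a ->] [b ->]|p q [a ->] [b ->]].
  - by exists c.
  - by exists (a + b); rewrite rmorphD.
  - by exists (a * b); rewrite rmorphM.
(* Sending ['X] to the last variable maps the polynomials over [mpoly n R] onto [mpoly n.+1 R]. *)
pose w : {rmorphism mpoly n R -> mpoly n.+1 R} := @mwiden n R.
have cw : commr_rmorph w (mpolyX R (mnm1 ord_max)) by move=> a; apply: mulrC.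
apply: (surj _ _ (horner_morph cw)); first exact: noetherian_poly.
elim/mpoly_ring_ind => [c|i|p q [a ->] [b ->]|p q [a ->] [b ->]].
- by exists (mpolyC n c)%:P; rewrite [RHS](horner_morphC cw) /= mwidenC.
- have [->|ni] := eqVneq i ord_max; first by exists 'X; rewrite [RHS](horner_morphX cw).
  have lt_in : (i < n)%N.
    rewrite ltn_neqAle -[X in _ && X]ltnS ltn_ord andbT.
    by apply: contra ni => /eqP e; apply/eqP/val_inj.
  exists (mpolyX R (mnm1 (Ordinal lt_in)))%:P.
  rewrite [RHS](horner_morphC cw) /= mwidenX mnmwiden1; congr (mpolyX _ (mnm1 _)).
  exact: val_inj.
- by exists (a + b); rewrite rmorphD.
- by exists (a * b); rewrite rmorphM.
Qed.

Lemma divr_expM (F : fieldType) (t w w' : F) k l : t != 0 ->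
  t ^+ (k + l) * w / (t ^+ l * w') = t ^+ k * (w / w').
Proof.
move=> t0; rewrite exprD [_ * t ^+ l]mulrC -[X in X / _]mulrA -mulf_div divff ?expf_neq0 //.
by rewrite mul1r mulrA.
Qed.

Lemma fraction_rep (D : idomainType) (z : {fraction D}) :
  exists a s : D, s != 0 /\ z = frac a / frac s.
Proof.
elim/quotW: z => r; exists r.1, r.2; split; first exact: denom_ratioP.
have d0 : frac r.2 != 0 :> {fraction D} by rewrite tofrac_eq0 denom_ratioP.
apply: (canRL (mulfK d0)); unlock FracField.tofrac.
rewrite -[LHS]FracField.pi_mul; apply/eqmodP => /=.
rewrite /= FracField.equivfE /FracField.mulf /= !numden_Ratio ?mulr1 ?oner_neq0 //;
  by rewrite ?mulf_neq0 ?denom_ratioP // mulrC.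
Qed.

Lemma mulr_div_cancel (F : fieldType) (a x z t : F) : z != 0 -> t != 0 ->
  t * (a * (z * x) / (z * t)) = a * x.
Proof. by move=> z0 t0; field; rewrite ?z0 ?t0. Qed.

(** * Polynomial functions and their local rings *)

Section PolynomialFunctions.
Variables (R : realType) (n : nat) (Y : irr_algset R n).
Local Notation A := (polyfun Y).
Local Notation K := (ratfun Y).
Implicit Types (f g s : A) (x y : 'rV[R]_n) (z w : K).

Lemma polyclassD p q : polyclass Y (p + q) = polyclass Y p + polyclass Y q.
Proof. by rewrite /polyclass rmorphD. Qed.

Lemma polyclass_eq0 p : polyclass Y p = 0 <-> forall x, irr_set Y x -> ev p x = 0.
Proof.
rewrite -polyclass0 polyclass_eq; split=> h x Yx.
  by rewrite h // /ev meval0.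
by rewrite h // /ev meval0.
Qed.

Lemma peval0 x : irr_set Y x -> peval (0 : A) x = 0.
Proof. by move=> Yx; rewrite -polyclass0 peval_polyclass // /ev meval0. Qed.

Lemma pevalD f g x : irr_set Y x -> peval (f + g) x = peval f x + peval g x.
Proof.
move=> Yx; rewrite -{1}[f]polyclass_repr -{1}[g]polyclass_repr -polyclassD.
by rewrite peval_polyclass // /ev mevalD.
Qed.

Lemma pevalB f g x : irr_set Y x -> peval (f - g) x = peval f x - peval g x.
Proof.
move=> Yx; rewrite -{1}[f]polyclass_repr -{1}[g]polyclass_repr -polyclassB.
by rewrite peval_polyclass // /ev mevalB.
Qed.

Lemma pevalX f k x : irr_set Y x -> peval (f ^+ k) x = peval f x ^+ k.
Proof.
move=> Yx; elim: k => [|k IHk]; first by rewrite !expr0 peval1.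
by rewrite !exprS pevalM // IHk.
Qed.

Lemma peval_sum (T : Type) (r : seq T) (F : T -> A) x : irr_set Y x ->
  peval (\sum_(i <- r) F i) x = \sum_(i <- r) peval (F i) x.
Proof.
move=> Yx; elim: r => [|i r IHr]; first by rewrite !big_nil peval0.
by rewrite !big_cons pevalD // IHr.
Qed.

Lemma peval_prod (T : Type) (r : seq T) (F : T -> A) x : irr_set Y x ->
  peval (\prod_(i <- r) F i) x = \prod_(i <- r) peval (F i) x.
Proof.
move=> Yx; elim: r => [|i r IHr]; first by rewrite !big_nil peval1.
by rewrite !big_cons pevalM // IHr.
Qed.

Lemma polyfun_eqP f g : f = g <-> forall x, irr_set Y x -> peval f x = peval g x.
Proof.
split=> [-> //|h]; rewrite -[f]polyclass_repr -[g]polyclass_repr.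
by apply/polyclass_eq => x /h.
Qed.

Lemma noetherian_polyfun : noetherian_ring A.
Proof.
pose pi : {rmorphism mpoly n R -> A} := \pi_(A)%qT.
apply: (noetherian_transfer (f := pi)); first exact: noetherian_mpoly.
move=> f; exists (repr f), 1, 1; rewrite !mul1r.
by have := polyclass_repr f; rewrite /polyclass /= => ->.
Qed.

Definition vanish_at y : set A := [set f | peval f y = 0].

Lemma vanish_at_prime y : irr_set Y y -> prime_set (vanish_at y).
Proof.
move=> Yy; split=> [||f g].
- split; first exact: peval0.
  by move=> a f g /= f0 g0; rewrite /vanish_at /= pevalD // pevalM // f0 g0 mulr0 addr0.
- by rewrite /vanish_at /= peval1 // => /eqP; rewrite oner_eq0.
- rewrite /vanish_at /= pevalM // => /eqP.
  by rewrite mulf_eq0 => /orP[/eqP|/eqP]; [left | right].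
Qed.

Definition coordinate i y : A := polyclass Y (mpolyX R (mnm1 i) - mpolyC n (y ord0 i)).

Lemma peval_coordinate i y x : irr_set Y x -> peval (coordinate i y) x = x ord0 i - y ord0 i.
Proof. by move=> Yx; rewrite peval_polyclass // /ev mevalB mevalXU mevalC. Qed.

(** Taylor expansion to order one: the maximal ideal of a real point is generated by the coordinates
    centred there. *)
Lemma coordinate_span y f : irr_set Y y ->
  exists c : 'I_n -> A, f = polyclass Y (mpolyC n (peval f y)) + \sum_i c i * coordinate i y.
Proof.
move=> Yy; rewrite -[f]polyclass_repr peval_polyclass //.
elim/mpoly_ring_ind: (repr f) => {f} [a|i|p q [c pE] [d qE]|p q [c pE] [d qE]].
- exists (fun=> 0); rewrite /ev mevalC big1 ?addr0 // => i _; exact: mul0r.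
- exists (fun j => (j == i)%:R); rewrite (bigD1 i) //= eqxx mul1r big1 => [|j].
    by rewrite addr0 /ev mevalXU /coordinate -polyclassD addrC subrK.
  by move=> /negPf ->; rewrite mul0r.
- exists (fun i => c i + d i); rewrite polyclassD {1}pE {1}qE addrACA.
  rewrite -polyclassD -mpolyCD /ev mevalD; congr (_ + _).
  by rewrite -big_split; apply: eq_bigr => i _; rewrite /= mulrDl.
- exists (fun i => c i * polyclass Y q + polyclass Y (mpolyC n (ev p y)) * d i).
  rewrite polyclassM {1}pE mulrDl {1}qE mulrDr -polyclassM -mpolyCM /ev mevalM.
  rewrite -addrA; congr (_ + _); rewrite mulr_sumr mulr_suml addrC -big_split.
  by apply: eq_bigr => i _ /=; rewrite mulrDl mulrA mulrAC.
Qed.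

(* An ideal maximal among those that contain [f] and have infinitely many zeros
   would be prime, strictly between 0 and the ideal of any of its zeros. *)
Lemma zero_set_finite f : dim_le1 A -> f != 0 ->
  finite_set [set x | irr_set Y x /\ peval f x = 0].
Proof.
move=> dimA f0; apply: contrapT => infZ.
pose Z (I : set A) := [set x | irr_set Y x /\ forall g, I g -> peval g x = 0].
pose F (I : set A) := [/\ ideal_set I, I f & infinite_set (Z I)].
have [| |I [idI If infI] maxI] :=
    @noetherian_maximal _ F [set g | exists a, g = a * f] noetherian_polyfun.
- by move=> I [].
- split; [split| |].
  + by exists 0; rewrite mul0r.
  + by move=> a _ _ [b ->] [c ->]; exists (a * b + c); rewrite mulrDl mulrA.
  + by exists 1; rewrite mul1r.
  + apply: contra_not infZ; apply: sub_finite_set => x [Yx fx]; split=> //.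
    by move=> _ [a ->]; rewrite pevalM // fx mulr0.
have prI : prime_set I.
  split=> // [I1|g h Igh].
    apply: infI; rewrite (_ : Z I = set0); first exact: finite_set0.
    apply/seteqP; split=> // x [Yx /(_ _ I1)]; rewrite peval1 // => /eqP.
    by rewrite oner_eq0.
  apply: contrapT => /not_orP[nIg nIh].
  have fin k : ~ I k -> finite_set (Z I `&` [set x | peval k x = 0]).
    move=> nIk; apply: contrapT => infk; apply: nIk.
    apply: (maxI (ideal_add I k)); last exact: ideal_add_mem.
      split; first exact: ideal_addP.
      - exact: ideal_add_sub.
      - apply: contra_not infk; apply: sub_finite_set => x [[Yx Ix] kx].
        split=> // _ [a [b [Ib ->]]].
        by rewrite pevalD // pevalM // kx mulr0 add0r Ix.
    exact: ideal_add_sub.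
  apply: infI; apply: sub_finite_set (_ : finite_set (_ `|` _)); last first.
    by rewrite finite_setU; split; [exact: fin nIg | exact: fin nIh].
  move=> x Zx; have [Yx Ix] := Zx; have /eqP := Ix _ Igh.
  by rewrite pevalM // mulf_eq0 => /orP[/eqP|/eqP] ?; [left | right].
have [x [Yx Ix]] := infinite_setN0 infI.
have [mI|/eqP] := dimA I (vanish_at x) f prI (vanish_at_prime Yx) If Ix; last first.
  exact/negP.
(* If the ideal of [x] is contained in [I], the coordinates centred at [x] belong to [I], which
   leaves [x] as its only zero. *)
apply: infI; apply: sub_finite_set (finite_set1 x) => y [Yy Iy] /=.
apply/rowP => i; have := Iy (coordinate i x).
rewrite peval_coordinate // => /(_ _)/subr0_eq; apply; apply: mI.
by rewrite /vanish_at /= peval_coordinate // subrr.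
Qed.

(** In dimension one the maximal ideal is the only prime of the local ring at [y] that contains [f],
    so [t] lies in the radical of (f) there. Otherwise some prime containing [f] would avoid all
    products [s * t ^+ k]; with [k = 0] it lies in the ideal of [y], hence equals it, yet it does
    not contain [t]. *)
Lemma power_mem_principal y f (t : A) : dim_le1 A -> irr_set Y y -> f != 0 -> peval t y = 0 ->
  exists s k b, peval s y != 0 /\ s * t ^+ k = f * b.
Proof.
move=> dimA Yy f0 ty; apply: contrapT => no.
pose S := [set g : A | exists s k, peval s y != 0 /\ g = s * t ^+ k].
have [| | | |P [prP sfP PS]] :=
    @prime_avoiding _ S [set g | exists b, g = f * b] noetherian_polyfun.
- split; first by exists 0; rewrite mulr0.
  move=> a _ _ [b ->] [c ->]; exists (a * b + c).
  by rewrite mulrDr mulrCA.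
- by exists 1, 0%N; rewrite peval1 // oner_neq0 expr0 mulr1.
- move=> _ _ [s [k [sy ->]]] [r [l [ry ->]]]; exists (s * r), (k + l)%N.
  by rewrite pevalM // mulf_neq0 // exprD mulrACA.
- move=> g [b gE] [s [k [sy gE']]]; apply: no; exists s, k, b.
  by rewrite -gE' gE.
have sPm : P `<=` vanish_at y.
  move=> g Pg; apply/eqP; apply: contrapT => /negP gy; apply: (PS g) => //.
  by exists g, 0%N; rewrite expr0 mulr1.
have Pf : P f by apply: sfP; exists 1; rewrite mulr1.
have [mP|/eqP] := dimA P (vanish_at y) f prP (vanish_at_prime Yy) Pf sPm; last first.
  exact/negP.
apply: (PS t); first by apply: mP.
by exists 1, 1%N; rewrite mul1r peval1 // oner_neq0.
Qed.

(* [z] lies in the local ring at [y] and [v] is its value there; in particular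
   [hasval y z 0] says that [z] lies in the maximal ideal. *)
Definition hasval y z v := exists a s : A,
  [/\ peval s y != 0, z = frac a / frac s & v = peval a y / peval s y].

Section Point.
Variable y : 'rV[R]_n.
Hypothesis Yy : irr_set Y y.

Lemma den_neq0 s : peval s y != 0 -> frac s != 0 :> K.
Proof. by rewrite tofrac_eq0; apply: contraNneq => ->; rewrite peval0. Qed.

Lemma hasval_frac f : hasval y (frac f) (peval f y).
Proof. by exists f, 1; rewrite peval1 // oner_neq0 tofrac1 !divr1. Qed.

Lemma hasval0 : hasval y 0 0.
Proof. by have := hasval_frac 0; rewrite peval0 // tofrac0. Qed.

Lemma hasval1 : hasval y 1 1.
Proof. by have := hasval_frac 1; rewrite peval1 // tofrac1. Qed.

Lemma hasval_inj z v v' : hasval y z v -> hasval y z v' -> v = v'.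
Proof.
move=> [a [s [sy -> ->]]] [b [t [ty /eqP + ->]]].
rewrite eqr_div ?den_neq0 // -!tofracM tofrac_eq => /eqP e; apply/eqP.
by rewrite eqr_div // -!pevalM // e.
Qed.

Lemma hasvalD z w v u : hasval y z v -> hasval y w u -> hasval y (z + w) (v + u).
Proof.
move=> [a [s [sy -> ->]]] [b [t [ty -> ->]]]; exists (a * t + b * s), (s * t).
by rewrite pevalM // mulf_neq0 // !addf_div ?den_neq0 // pevalD // tofracD !tofracM !pevalM.
Qed.

Lemma hasvalM z w v u : hasval y z v -> hasval y w u -> hasval y (z * w) (v * u).
Proof.
move=> [a [s [sy -> ->]]] [b [t [ty -> ->]]]; exists (a * b), (s * t).
by rewrite !pevalM // mulf_neq0 // !mulf_div !tofracM.
Qed.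

Lemma hasvalN z v : hasval y z v -> hasval y (- z) (- v).
Proof.
move=> /(hasvalM (hasval_frac (- 1))); rewrite tofracN tofrac1 mulN1r.
by rewrite -[- 1 : A]sub0r pevalB // peval0 // peval1 // sub0r mulN1r.
Qed.

Lemma hasvalV z v : hasval y z v -> v != 0 -> hasval y z^-1 v^-1.
Proof.
move=> [a [s [sy -> ->]]]; rewrite mulf_eq0 invr_eq0 (negPf sy) orbF => ay.
by exists s, a; rewrite !invf_div.
Qed.

Lemma hasvalX z v k : hasval y z v -> hasval y (z ^+ k) (v ^+ k).
Proof.
by move=> zv; elim: k => [|k IHk]; [rewrite !expr0; exact: hasval1 | rewrite !exprS; exact: hasvalM].
Qed.

Lemma hasval_sum (T : Type) (r : seq T) (Q : pred T) (F : T -> K) (v : T -> R) :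
  (forall i, Q i -> hasval y (F i) (v i)) ->
  hasval y (\sum_(i <- r | Q i) F i) (\sum_(i <- r | Q i) v i).
Proof.
move=> Fv; elim: r => [|i r IHr]; first by rewrite !big_nil; exact: hasval0.
by rewrite !big_cons; case: ifP => // Qi; apply: hasvalD => //; apply: Fv.
Qed.

Lemma common_denominator (T : finType) (w : T -> K) (v : T -> R) :
  (forall i, hasval y (w i) (v i)) ->
  exists (s : A) (a : T -> A), peval s y != 0 /\ forall i, frac s * w i = frac (a i).
Proof.
move=> wv; have [a aP] := choice wv; have [s sP] := choice aP.
exists (\prod_i s i), (fun i => (\prod_(j | j != i) s j) * a i); split.
  rewrite peval_prod //; apply/prodf_neq0 => i _; by have [] := sP i.
move=> i; rewrite (bigD1 i) //= tofracM; have [siy -> _] := sP i.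
by rewrite tofracM mulrC mulrA divfK ?den_neq0 // mulrC.
Qed.

Lemma vanishing_span z : hasval y z 0 -> exists w : 'I_n -> K,
  (forall i, exists v, hasval y (w i) v) /\ z = \sum_i w i * frac (coordinate i y).
Proof.
move=> [a [s [sy -> /esym/eqP]]]; rewrite mulf_eq0 invr_eq0 (negPf sy) orbF.
move=> /eqP a0; have [c aE] := coordinate_span a Yy.
exists (fun i => frac (c i) / frac s); split=> [i|].
  by exists (peval (c i) y / peval s y), (c i), s.
rewrite {1}aE a0 (_ : polyclass Y (mpolyC n 0) = 0); last first.
  by rewrite mpolyC0 polyclass0.
rewrite add0r rmorph_sum mulr_suml; apply: eq_bigr => i _.
by rewrite rmorphM mulrAC.
Qed.

Definition uniformizer t := [/\ t != 0, hasval y t 0 &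
  forall z, hasval y z 0 -> exists w v, hasval y w v /\ z = t * w].

(** Integrality is over the global ring, as the normalization provides it; [local_determinant_trick]
    clears denominators to get there from the local ring. *)
Definition locally_normal :=
  forall z, integralOver (@FracField.tofrac A) z -> exists v, hasval y z v.

Lemma determinant_trick k (xi : 'rV[K]_k) z (c : 'M[A]_k) : xi != 0 ->
  z *: xi = xi *m map_mx frac c -> integralOver (@FracField.tofrac A) z.
Proof.
move=> xi0 zxi; exists (char_poly c); first exact: char_poly_monic.
rewrite map_char_poly -eigenvalue_root_char.
by apply/eigenvalueP; exists xi.
Qed.

(** Multiplication by [z] maps the maximal ideal into itself, by a matrix over the local ring. Once
    a common denominator [s] is cleared, [s * z] is an eigenvalue of a matrix over the global ring,
    hence integral; and [s] is a unit at [y]. *)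
Lemma local_determinant_trick (z : K) : locally_normal ->
  (exists i, coordinate i y != 0) ->
  (forall i, hasval y (z * frac (coordinate i y)) 0) -> exists v, hasval y z v.
Proof.
move=> lnY [i0 xi0] zM.
have [w wP] := choice (fun i => vanishing_span (zM i)).
have [v wv] : exists v : 'I_n * 'I_n -> R, forall ij, hasval y (w ij.1 ij.2) (v ij).
  suff /choice[v wv] : forall ij : 'I_n * 'I_n, exists v, hasval y (w ij.1 ij.2) v by exists v.
  by move=> [i j]; apply: (wP i).1.
have [s [a [sy aE]]] := common_denominator wv.
pose xi : 'rV[K]_n := \row_i frac (coordinate i y).
have [|u [b [r [ry szE _]]]] := lnY (frac s * z).
  apply: (@determinant_trick n xi _ (\matrix_(i, j) a (j, i))).
    by apply/eqP => /rowP/(_ i0); rewrite !mxE => /eqP; rewrite tofrac_eq0; apply/negP.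
  apply/rowP => j; rewrite !mxE -mulrA (wP j).2 mulr_sumr; apply: eq_bigr => i _.
  by rewrite !mxE -aE /= mulrA mulrC.
exists (peval b y / peval (r * s) y), b, (r * s).
rewrite pevalM // mulf_neq0 //; split=> //.
apply: (mulfI (den_neq0 sy)); rewrite szE tofracM invfM.
by rewrite [RHS]mulrC -!mulrA mulVf ?den_neq0 // mulr1.
Qed.

(* Let [a] be in the maximal ideal [M]. Multiplying 1 by powers of the
   coordinates as long as it stays outside (a), one finds [b] outside (a) with
   [b M] inside (a). If [b/a] mapped [M] into itself, it would be integral, hence
   in the local ring; so [b/a] maps some coordinate to a unit, and that
   coordinate generates [M]. *)
Lemma uniformizer_exists : dim_le1 A -> locally_normal ->
  (exists i, coordinate i y != 0) -> exists i, uniformizer (frac (coordinate i y)).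
Proof.
move=> dimA lnY exi; have [i0 xi0] := exi.
pose a : K := frac (coordinate i0 y); have a0 : a != 0 by rewrite tofrac_eq0.
pose inaO z := exists w v, hasval y w v /\ z = a * w.
have powers i : exists N, inaO (frac (coordinate i y) ^+ N).
  have [|s [k [b [sy e]]]] := @power_mem_principal y _ (coordinate i y) dimA Yy xi0.
    by rewrite peval_coordinate // subrr.
  exists k, (frac b / frac s), (peval b y / peval s y); split; first by exists b, s.
  apply: (mulfI (den_neq0 sy)); rewrite -tofracXn -tofracM e tofracM.
  by rewrite [RHS]mulrC -!mulrA mulVf ?den_neq0 // mulr1.
have [b [bO nb bxi]] : exists b, [/\ exists v, hasval y b v, ~ inaO b &
    forall i, i \in enum 'I_n -> inaO (b * frac (coordinate i y))].
  elim: (enum 'I_n) => [|i r [b [[v bv] nb bxi]]].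
    exists 1; split=> //; first by exists 1; exact: hasval1.
    move=> [w [u [wu e]]]; have := hasvalM (hasval_frac (coordinate i0 y)) wu.
    rewrite -/a -e peval_coordinate // subrr mul0r => /(hasval_inj hasval1)/eqP.
    by rewrite oner_eq0.
  have exN : exists N, `[< inaO (b * frac (coordinate i y) ^+ N) >].
    have [N [w [u [wu e]]]] := powers i; exists N; apply/asboolP.
    exists (b * w), (v * u); split; first exact: hasvalM.
    by rewrite e mulrCA.
  case: (ex_minnP exN) => [[|N]] /asboolP inN minN.
    by case: nb; rewrite expr0 mulr1 in inN.
  exists (b * frac (coordinate i y) ^+ N); split.
  - by exists (v * peval (coordinate i y) y ^+ N); apply: hasvalM => //; apply/hasvalX/hasval_frac.
  - by move=> /asboolP/minN; rewrite ltnn.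
  - move=> j; rewrite inE => /predU1P[->|/bxi[w [u [wu e]]]].
      by rewrite -mulrA -exprSr.
    exists (w * frac (coordinate i y) ^+ N), (u * peval (coordinate i y) y ^+ N).
    split; first by apply: hasvalM => //; apply/hasvalX/hasval_frac.
    by rewrite mulrAC e mulrA.
have zO i : exists u, hasval y (b / a * frac (coordinate i y)) u.
  have [|w [u [wu e]]] := bxi i; first by rewrite mem_enum.
  by exists u; rewrite mulrAC e mulrAC divff ?mul1r.
have [u zu] := choice zO.
have [[i ui]|all0] := pselect (exists i, u i != 0); last first.
  have [|v zv] := @local_determinant_trick (b / a) lnY exi.
    move=> i; have -> : 0 = u i; last exact: zu.
    by apply/eqP; rewrite eq_sym; apply: contrapT => /negP ui; apply: all0; exists i.
  by case: nb; exists (b / a), v; split=> //; rewrite mulrC divfK.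
exists i; set z := b / a in zu; set t := frac (coordinate i y) in zu *.
have zt0 : z * t != 0.
  apply: contra ui => /eqP zt0; apply/eqP; apply: (@hasval_inj 0); last exact: hasval0.
  by rewrite -zt0; apply: zu.
have t0 : t != 0 by apply: contra zt0 => /eqP ->; rewrite mulr0.
split=> // [|f /vanishing_span[w [/choice[v wv] ->]]].
  by have := hasval_frac (coordinate i y); rewrite peval_coordinate // subrr.
(* Each coordinate x_j equals t (z x_j) / (z t), and z t is a unit because its value [u i] is
   nonzero. *)
exists (\sum_j w j * (z * frac (coordinate j y)) / (z * t)).
exists (\sum_j v j * u j / u i); split.
  apply: hasval_sum => j _; apply: hasvalM; last exact: hasvalV (zu i) ui.
  exact: hasvalM (wv j) (zu j).
rewrite mulr_sumr; apply: eq_bigr => j _.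
have z0 : z != 0 by apply: contra zt0 => /eqP ->; rewrite mul0r.
by rewrite (mulr_div_cancel (w j) (frac (coordinate j y)) z0 t0).
Qed.

Section Valuation.
Variable t : K.
Hypothesis ut : uniformizer t.
Hypothesis dimA : dim_le1 A.

(** Some power of [t] is a multiple of [f]. For the least such power the cofactor is a unit: if it
    vanished at [y], a factor [t] could be cancelled. *)
Lemma unif_decomp (f : K) v : f != 0 -> hasval y f v -> exists k w u,
  [/\ hasval y w u, u != 0 & f = t ^+ k * w].
Proof.
move=> f0 fv; have [t0 tv tgen] := ut.
have exN : exists N, `[< exists w u, hasval y w u /\ t ^+ N = f * w >].
  have [a [s [sy fE _]]] := fv; have [b [r [ry tE /esym/eqP]]] := tv.
  rewrite mulf_eq0 invr_eq0 (negPf ry) orbF => /eqP b0.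
  have a0 : a != 0 by apply: contra f0 => /eqP a0; rewrite fE a0 tofrac0 mul0r.
  have [q [k [c [qy e]]]] := power_mem_principal dimA Yy a0 b0.
  exists k; apply/asboolP.
  exists (frac (c * s) / frac (q * r ^+ k)), (peval (c * s) y / peval (q * r ^+ k) y).
  have rky : peval (r ^+ k) y != 0 by rewrite pevalX // expf_neq0.
  have dy : peval (q * r ^+ k) y != 0 by rewrite pevalM // mulf_neq0.
  split; first by exists (c * s), (q * r ^+ k).
  rewrite fE tE expr_div_n -!tofracXn mulf_div -!tofracM; apply/eqP.
  rewrite eqr_div; [|exact: den_neq0|by apply: den_neq0; rewrite // pevalM // mulf_neq0].
  rewrite -!tofracM tofrac_eq; apply/eqP.
  transitivity ((q * b ^+ k) * (s * r ^+ k)); last by rewrite e !mulrA [X in X * _]mulrAC.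
  by rewrite [s * (q * _)]mulrA mulrCA [s * q]mulrC [RHS]mulrACA.
case: (ex_minnP exN) => N /asboolP[w [u [wu e]]] minN.
have w0 : w != 0 by apply: contraNneq (expf_neq0 N t0) => w0; rewrite e w0 mulr0.
have [u0|u0] := eqVneq u 0; last first.
  exists N, w^-1, u^-1; rewrite invr_eq0; split=> //; first exact: hasvalV.
  by rewrite e mulfK.
rewrite u0 in wu; have [w' [u' [wu' wE]]] := tgen w wu.
case: N => [|N] in e minN *.
  exists 0%N, f, v; rewrite expr0 mul1r; split=> //.
  apply: contraTneq (oner_neq0 R) => v0; rewrite v0 in fv.
  have := hasvalM fv wu; rewrite -e expr0 mulr0 => /(hasval_inj hasval1) ->.
  by rewrite eqxx.
suff /minN : `[< exists w u, hasval y w u /\ t ^+ N = f * w >] by rewrite ltnn.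
apply/asboolP; exists w', u'; split=> //; apply: (mulfI t0).
by rewrite -exprS e wE mulrCA.
Qed.

Lemma valuation_ring z : (exists v, hasval y z v) \/ hasval y z^-1 0.
Proof.
have [a [s [s0 zE]]] := fraction_rep z; have [t0 tv _] := ut.
have [a0|a0] := eqVneq a 0.
  by left; exists 0; rewrite zE a0 tofrac0 mul0r; exact: hasval0.
have [||k [w [u [wu u0 aE]]]] := @unif_decomp (frac a) (peval a y).
- by rewrite tofrac_eq0.
- exact: hasval_frac.
have [||l [w' [u' [wu' u0' sE]]]] := @unif_decomp (frac s) (peval s y).
- by rewrite tofrac_eq0.
- exact: hasval_frac.
have [le_lk|lt_kl] := leqP l k.
  left; exists (0 ^+ (k - l) * (u / u')).
  rewrite zE aE sE -{1}(subnK le_lk) (divr_expM _ _ _ _ t0).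
  apply: hasvalM; first exact: hasvalX.
  by apply: hasvalM => //; apply: hasvalV.
right; rewrite zE aE sE -{1}(subnK (ltnW lt_kl)) invf_div (divr_expM _ _ _ _ t0).
have tl : hasval y (t ^+ (l - k)) 0.
  by have := hasvalX (l - k) tv; rewrite expr0n subn_eq0 leqNgt lt_kl.
by have := hasvalM tl (hasvalM wu' (hasvalV wu u0)); rewrite mul0r.
Qed.

End Valuation.
End Point.
End PolynomialFunctions.
(** * Real points near a point with a uniformizer *)

(** Makes row vectors a complete normed space, the setting of [banach_fixed_point]. *)
HB.instance Definition _ (R : realType) (m n : nat) :=
  Complete.on 'M[R]_(m, n).

Section RowNorm.
Variables (R : realType) (n : nat).
Implicit Types v : 'rV[R]_n.

Lemma coord_le_norm v i : `|v ord0 i| <= `|v|.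
Proof.
rewrite [leRHS]mx_normrE; apply/bigmax_geP; right => /=.
by exists (ord0, i).
Qed.

Lemma norm_le_coord v c : 0 <= c -> (forall i, `|v ord0 i| <= c) -> `|v| <= c.
Proof.
move=> c0 vc; rewrite [leLHS]mx_normrE; apply/bigmax_leP.
by split=> // -[i j] _; rewrite ord1.
Qed.

End RowNorm.

Section LocallyLipschitz.
Variables (R : realType) (n : nat) (y : 'rV[R]_n).
Implicit Types (h k : 'rV[R]_n -> R).

(** A Lipschitz bound rather than continuity, since a contraction is to be built. The radius ranges
    over a filter so that finitely many such conditions can be imposed together. *)
Definition lipschitz_near h := exists M, 0 <= M /\
  \forall d \near 0^'+, forall x x', `|x - y| <= d -> `|x' - y| <= d ->
    `|h x - h x'| <= M * `|x - x'|.

Lemma near_right_small (c e : R) : 0 <= c -> 0 < e ->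
  \forall d \near 0^'+, c * d <= e.
Proof.
move=> c0 e0; near=> d.
have d0 : 0 < d by near: d; exact: nbhs_right_gt.
have : d < e / (c + 1) by near: d; apply: nbhs_right_lt; rewrite divr_gt0 // ltr_wpDl.
rewrite ltr_pdivlMr ?ltr_wpDl // => /ltW; apply: le_trans.
by rewrite mulrDr mulr1 mulrC lerDl ltW.
Unshelve. all: by end_near. Qed.

Lemma lipschitz_near_cont h e : lipschitz_near h -> 0 < e ->
  \forall d \near 0^'+, forall x, `|x - y| <= d -> `|h x - h y| <= e.
Proof.
move=> [M [M0 hM]] e0; near=> d.
have d0 : 0 < d by near: d; exact: nbhs_right_gt.
have Md : M * d <= e by near: d; exact: near_right_small.
have hd : forall x x', `|x - y| <= d -> `|x' - y| <= d ->
    `|h x - h x'| <= M * `|x - x'| by near: d.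
move=> x xd; apply: le_trans Md; apply: le_trans (hd x y xd _) _.
  by rewrite subrr normr0 ltW.
by rewrite ler_wpM2l.
Unshelve. all: by end_near. Qed.

Lemma lipschitz_near_cst c : lipschitz_near (fun=> c).
Proof.
by exists 0; split=> //; apply: nearW => d x x' _ _; rewrite subrr normr0 mul0r.
Qed.

Lemma lipschitz_near_coord i : lipschitz_near (fun x => x ord0 i).
Proof.
exists 1; split=> //; apply: nearW => d x x' _ _; rewrite mul1r.
by have := coord_le_norm (x - x') i; rewrite !mxE.
Qed.

Lemma lipschitz_nearD h k : lipschitz_near h -> lipschitz_near k ->
  lipschitz_near (fun x => h x + k x).
Proof.
move=> [M [M0 hM]] [N [N0 kN]]; exists (M + N); split; first exact: addr_ge0.
near=> d => x x' xd xd'; rewrite opprD addrACA (le_trans (ler_normD _ _)) //.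
rewrite mulrDl lerD //.
  by move: x x' xd xd'; near: d.
by move: x x' xd xd'; near: d.
Unshelve. all: by end_near. Qed.

Lemma lipschitz_nearM h k : lipschitz_near h -> lipschitz_near k ->
  lipschitz_near (fun x => h x * k x).
Proof.
move=> lh lk; have [M [M0 hM]] := lh; have [N [N0 kN]] := lk.
exists ((`|h y| + 1) * N + (`|k y| + 1) * M); split.
  by rewrite addr_ge0 // mulr_ge0 // addr_ge0.
near=> d => x x' xd xd'.
have -> : h x * k x - h x' * k x' = h x * (k x - k x') + k x' * (h x - h x').
  by ring.
have hx : `|h x| <= `|h y| + 1.
  rewrite -lerBlDl (le_trans (lerB_dist _ _)) //.
  by move: x xd {x' xd'}; near: d; exact: lipschitz_near_cont.
have kx' : `|k x'| <= `|k y| + 1.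
  rewrite -lerBlDl (le_trans (lerB_dist _ _)) //.
  by move: x' xd' {x xd hx}; near: d; exact: lipschitz_near_cont.
rewrite (le_trans (ler_normD _ _)) // !normrM mulrDl -!mulrA lerD //.
  by rewrite ler_pM // {hx kx'}; move: x x' xd xd'; near: d.
by rewrite ler_pM // {hx kx'}; move: x x' xd xd'; near: d.
Unshelve. all: by end_near. Qed.

Lemma lipschitz_nearV h : lipschitz_near h -> h y != 0 ->
  lipschitz_near (fun x => (h x)^-1).
Proof.
move=> lh hy0; have [M [M0 hM]] := lh; pose c := `|h y| / 2.
have c0 : 0 < c by rewrite divr_gt0 // normr_gt0.
exists (c^-1 * c^-1 * M); split; first by rewrite !mulr_ge0 // invr_ge0 ltW.
near=> d => x x' xd xd'.
have low z : `|z - y| <= d -> c <= `|h z|.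
  move=> zd; have : `|h z - h y| <= c.
    by move: z zd {x x' xd xd'}; near: d; exact: lipschitz_near_cont.
  rewrite distrC => hz; have := le_trans (lerB_dist _ _) hz.
  by rewrite /c; lra.
have [hx hx'] := (low x xd, low x' xd').
have nz z : c <= `|h z| -> h z != 0.
  by move=> hz; rewrite -normr_gt0 (lt_le_trans c0).
have -> : (h x)^-1 - (h x')^-1 = (h x)^-1 * (h x')^-1 * (h x' - h x).
  by field; rewrite !nz.
have cV z : c <= `|h z| -> `|h z|^-1 <= c^-1.
  by move=> hz; rewrite lef_pV2 // posrE // (lt_le_trans c0).
rewrite !normrM !normfV -[leRHS]mulrA; apply: ler_pM; rewrite ?mulr_ge0 ?invr_ge0 //.
  by apply: ler_pM; rewrite ?invr_ge0 //; exact: cV.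
by rewrite distrC {hx hx'}; move: x x' xd xd' {low}; near: d.
Unshelve. all: by end_near. Qed.

Lemma lipschitz_near_ev p : lipschitz_near (ev p).
Proof.
elim/mpoly_ring_ind: p => [c|i|p q lp lq|p q lp lq].
- rewrite (_ : ev _ = fun=> c); first exact: lipschitz_near_cst.
  by apply/funext => x; rewrite /ev mevalC.
- rewrite (_ : ev _ = fun x => x ord0 i); first exact: lipschitz_near_coord.
  by apply/funext => x; rewrite /ev mevalXU.
- rewrite (_ : ev _ = fun x => ev p x + ev q x); first exact: lipschitz_nearD.
  by apply/funext => x; rewrite /ev mevalD.
- rewrite (_ : ev _ = fun x => ev p x * ev q x); first exact: lipschitz_nearM.
  by apply/funext => x; rewrite /ev mevalM.
Qed.

(* A fixed point of the contraction x |-> y + t r(x), for small t; the bound on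
   the [B l] is uniform on the ball containing these points. *)
Lemma rational_curve_point (I : finType) (r : 'I_n -> 'rV[R]_n -> R)
    (B : I -> 'rV[R]_n -> R) (e : R) :
  (forall j, lipschitz_near (r j)) -> (forall l, lipschitz_near (B l)) -> 0 < e ->
  exists C d, [/\ 0 < d, 0 <= C, d < e,
    (forall l x, `|x - y| <= d -> `|B l x| <= C) &
    \forall t \near 0^'+, exists2 x, `|x - y| <= d &
      forall j, x ord0 j = y ord0 j + t * r j x].
Proof.
move=> /choice[M MP] lB e0.
pose C := \sum_l (`|B l y| + 1).
pose L := \sum_j M j; have L0 : 0 <= L by apply: sumr_ge0 => j _; have [] := MP j.
pose N := \sum_j (`|r j y| + 1).
have N0 : 0 <= N by apply: sumr_ge0 => j _; rewrite addr_ge0.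
have [d [d0 de dB dr dL]] : exists d, [/\ 0 < d, d < e,
    (forall l x, `|x - y| <= d -> `|B l x - B l y| <= 1),
    (forall j x, `|x - y| <= d -> `|r j x - r j y| <= 1) &
    forall j x x', `|x - y| <= d -> `|x' - y| <= d -> `|r j x - r j x'| <= M j * `|x - x'|].
  near (0 : R)^'+ => d; exists d; split.
  - by near: d; exact: nbhs_right_gt.
  - by near: d; exact: nbhs_right_lt.
  - near: d; apply: filter_forall => l; exact: lipschitz_near_cont.
  - near: d; apply: filter_forall => j; apply: lipschitz_near_cont => //.
    by exists (M j).
  - by near: d; apply: filter_forall => j; have [] := MP j.
have le_sum (J : finType) (F : J -> R) j : (forall i, 0 <= F i) -> F j <= \sum_i F i.
  by move=> F0; rewrite (bigD1 j) //= lerDl sumr_ge0.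
exists C, d; split=> //.
- by apply: sumr_ge0 => l _; rewrite addr_ge0.
- move=> l x xd; apply: le_trans (le_sum _ (fun l => `|B l y| + 1) l _); last first.
    by move=> i; rewrite addr_ge0.
  by rewrite -lerBlDl (le_trans (lerB_dist _ _)) // dB.
near=> t; have t0 : 0 < t by near: t; exact: nbhs_right_gt.
(* The first bound makes the ball of radius [d] stable under the map, the second makes the map a
   contraction by one half. The radius was fixed before [t], so [C] is independent of [t]. *)
have tN : N * t <= d by near: t; exact: near_right_small.
have tL : L * t <= 2^-1 by near: t; apply: near_right_small => //; rewrite invr_gt0.
pose U : set 'rV[R]_n := closed_ball_ Num.norm y d.
pose T (x : 'rV[R]_n) : 'rV[R]_n := \row_j (y ord0 j + t * r j x).
have UT : {homo T : x / U x >-> U x}.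
  move=> x; rewrite /U /closed_ball_ /= distrC => xd; rewrite distrC.
  apply: norm_le_coord => [|j]; first exact: ltW.
  rewrite !mxE addrC addKr normrM (gtr0_norm t0) mulrC (le_trans _ tN) //.
  apply: ler_wpM2r; [exact: ltW|apply: le_trans (le_sum _ (fun j => `|r j y| + 1) j _)].
    by rewrite -lerBlDl (le_trans (lerB_dist _ _)) // dr.
  by move=> i; rewrite addr_ge0.
have [|||x Ux xE] := @banach_fixed_point R 'rV[R]_n U (mkfun_fun UT).
- exists (2^-1)%:nng; split=> /=; first lra.
  move=> -[x x'] /= [Ux Ux']; rewrite /U /closed_ball_ /= in Ux Ux'.
  rewrite distrC in Ux; rewrite distrC in Ux'.
  apply: norm_le_coord => [|j]; first by rewrite mulr_ge0 // invr_ge0.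
  rewrite !mxE opprD addrACA subrr add0r -mulrBr normrM (gtr0_norm t0).
  apply: le_trans (ler_wpM2r (normr_ge0 _) tL); rewrite mulrC mulrAC.
  apply: ler_wpM2r; first exact: ltW.
  apply: le_trans (dL j x x' Ux Ux') _; apply: ler_wpM2r => //.
  by apply: le_sum => i; have [] := MP i.
- by rewrite /U -closed_ballE //; exact: closed_ball_closed.
- by exists y; rewrite /U /closed_ball_ /= subrr normr0 ltW.
exists x; first by rewrite distrC; exact: Ux.
by move=> j; rewrite {1}xE mxE.
Unshelve. all: by end_near. Qed.

End LocallyLipschitz.

Section NotIsolated.
Variables (R : realType) (n : nat) (Y : irr_algset R n) (y : 'rV[R]_n).
Hypothesis Yy : irr_set Y y.

Lemma vanishing_point x :
  (forall p, p \in vanishing Y -> ev p x = 0) -> irr_set Y x.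
Proof.
have [S YE] := irr_algebraic Y; move=> h; rewrite YE => p Sp; apply: h.
by apply/vanishingP => z; rewrite YE => /(_ p Sp).
Qed.

Lemma vanishing_ideal_set : ideal_set [set p | p \in vanishing Y].
Proof. by have [v0 _ vD] := vanishing_idealr Y; split=> // a p q; apply: vD. Qed.

(* Division by the coordinate [i], modulo the equations on [x] in the
   hypothesis: these hold on [Y], and also at the points constructed as fixed
   points. *)
Lemma coordinate_division i (s : mpoly n R) (a : 'I_n -> mpoly n R) p :
  exists d q, forall x,
    (forall j, ev s x * (x ord0 j - y ord0 j) =
               (x ord0 i - y ord0 i) * ev (a j) x) ->
    ev s x ^+ d * ev p x = ev s x ^+ d * ev p y + (x ord0 i - y ord0 i) * ev q x.
Proof.
elim/mpoly_ring_ind: p => [c|j|p p' [d [q pE]] [d' [q' p'E]]|p p' [d [q pE]] [d' [q' p'E]]].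
- by exists 0%N, 0 => x _; rewrite /ev !mevalC ?meval0 mulr0 addr0.
- exists 1%N, (a j) => x /(_ j); rewrite expr1 /ev !mevalXU => <-.
  by ring.
- exists (d + d')%N, (s ^+ d' * q + s ^+ d * q') => x xG.
  have [e e'] := (pE x xG, p'E x xG).
  have evX k : ev (s ^+ k) x = ev s x ^+ k by rewrite /ev rmorphXn.
  rewrite /ev !mevalD !mevalM -!/(ev _ _) !evX exprD.
  transitivity (ev s x ^+ d' * (ev s x ^+ d * ev p x) + ev s x ^+ d * (ev s x ^+ d' * ev p' x)).
    by ring.
  by rewrite e e'; ring.
- exists (d + d')%N, (s ^+ d * mpolyC n (ev p y) * q' + q * s ^+ d' * p') => x xG.
  have [e e'] := (pE x xG, p'E x xG).
  have evX k : ev (s ^+ k) x = ev s x ^+ k by rewrite /ev rmorphXn.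
  rewrite /ev !mevalD !mevalM !mevalC -!/(ev _ _) !evX exprD.
  transitivity ((ev s x ^+ d * ev p x) * (ev s x ^+ d' * ev p' x)).
    by ring.
  by rewrite e mulrDl [X in ev s x ^+ d * ev p y * X]e'; ring.
Qed.

(* A fixed point x satisfies the equations used in [coordinate_division]. So the
   values at x of generators g_k of the vanishing ideal of [Y] satisfy
   s(x)^d g_k(x) = t sum_l b_kl(x) g_l(x), which forces them to be zero for t
   small. *)
Lemma not_isolated i e : uniformizer y (frac (coordinate Y i y)) -> 0 < e ->
  exists2 x, irr_set Y x & x ord0 i != y ord0 i /\ `|x - y| < e.
Proof.
move=> [xi0 xiv xigen] e0; rewrite tofrac_eq0 in xi0.
have gen j : exists w v, hasval y w v /\ frac (coordinate Y j y) = frac (coordinate Y i y) * w.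
  apply: xigen; have := hasval_frac Yy (coordinate Y j y).
  by rewrite peval_coordinate // subrr.
have [w wP] := choice gen; have [v vP] := choice wP.
have [s [a [sy aE]]] := common_denominator Yy (fun j => (vP j).1).
(* Taking [S] itself as numerator at [j = i] makes the quotient there exactly 1, so that a fixed
   point satisfies x_i - y_i = t. *)
pose S := repr s; pose a' j := if j == i then S else repr (a j).
have YG x : irr_set Y x -> forall j,
    ev S x * (x ord0 j - y ord0 j) = (x ord0 i - y ord0 i) * ev (a' j) x.
  move=> Yx j; rewrite /a'; case: eqP => [->|_]; first exact: mulrC.
  rewrite -[ev S x]/(peval s x) -[ev _ x]/(peval (a j) x) -!(peval_coordinate _ _ Yx).
  rewrite -!pevalM //; congr peval; apply/eqP; rewrite -tofrac_eq !tofracM -aE.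
  by rewrite (vP j).2 mulrCA.
have divY p : p \in vanishing Y -> exists d q, q \in vanishing Y /\ forall x,
    (forall j, ev S x * (x ord0 j - y ord0 j) = (x ord0 i - y ord0 i) * ev (a' j) x) ->
    ev S x ^+ d * ev p x = (x ord0 i - y ord0 i) * ev q x.
  move=> Ip; have [d [q qP]] := coordinate_division i S a' p.
  have py : ev p y = 0 by move/vanishingP: Ip; apply.
  have qP' x : (forall j, ev S x * (x ord0 j - y ord0 j) = (x ord0 i - y ord0 i) * ev (a' j) x) ->
      ev S x ^+ d * ev p x = (x ord0 i - y ord0 i) * ev q x.
    by move=> /qP ->; rewrite py mulr0 add0r.
  (* The product of [q] with the coordinate [i] vanishes on [Y]; that coordinate is nonzero in a
     domain, so [q] vanishes on [Y]. *)
  exists d, q; split=> //; apply/vanishingP.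
  apply/(polyclass_eq0 Y q)/eqP; rewrite -(inj_eq (mulfI xi0)) mulr0; apply/eqP.
  apply/polyfun_eqP => x Yx; rewrite pevalM // peval_coordinate // peval_polyclass // peval0 //.
  rewrite -qP'; last exact: YG.
  by move/vanishingP: Ip => ->; rewrite ?mulr0.
have [g [gI gspan]] := noetherian_span (@noetherian_mpoly R n) vanishing_ideal_set.
have divg (k : 'I_(size g)) : exists d (b : 'I_(size g) -> mpoly n R), forall x,
    (forall j, ev S x * (x ord0 j - y ord0 j) = (x ord0 i - y ord0 i) * ev (a' j) x) ->
    ev S x ^+ d * ev g`_k x = (x ord0 i - y ord0 i) * \sum_l ev (b l) x * ev g`_l x.
  have [|d [q [Iq qP]]] := divY g`_k; first by apply: gI; rewrite mem_nth.
  have [b qE] := gspan q Iq; exists d, b => x /qP ->.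
  rewrite qE /ev raddf_sum; congr (_ * _); apply: eq_bigr => l _.
  by rewrite /= mevalM.
have [d dP] := choice divg; have [b bP] := choice dP.
have lS : lipschitz_near y (ev S) by exact: lipschitz_near_ev.
have [d1 [d10 Sd1]] : exists d1, 0 < d1 /\ forall x, `|x - y| <= d1 -> ev S x != 0.
  near (0 : R)^'+ => d1; exists d1; split; first by near: d1; exact: nbhs_right_gt.
  move=> x xd1; have : `|ev S x - ev S y| <= `|ev S y| / 2.
    move: x xd1; near: d1; apply: lipschitz_near_cont => //.
    by rewrite divr_gt0 // normr_gt0.
  apply: contraTneq => ->; rewrite sub0r normrN -ltNge.
  by rewrite ltr_pdivrMr // ltr_pMr ?normr_gt0 // ltr1n.
pose r j x := ev (a' j) x / ev S x.
(* What needs a bound independent of [t]: the coefficients [b] and the inverses of the powers of [S]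
   that multiply the generators. *)
pose B (k : ('I_(size g) * 'I_(size g)) + 'I_(size g)) x :=
  match k with inl kl => ev (b kl.1 kl.2) x | inr k => (ev (S ^+ d k) x)^-1 end.
have evX x k : ev (S ^+ k) x = ev S x ^+ k by rewrite /ev rmorphXn.
have [|||C [d2 [d20 C0 d2e BC near_x]]] :=
    @rational_curve_point R n y _ r B (Num.min e d1).
- move=> j; apply: lipschitz_nearM; first exact: lipschitz_near_ev.
  exact: lipschitz_nearV.
- case=> [kl|k]; first exact: lipschitz_near_ev.
  by apply: lipschitz_nearV; [exact: lipschitz_near_ev | rewrite evX expf_neq0].
- by rewrite lt_min e0.
rewrite lt_min in d2e; have [d2e1 d2d1] := andP d2e.
near (0 : R)^'+ => t; have t0 : 0 < t by near: t; exact: nbhs_right_gt.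
have [x xd xE] : exists2 x, `|x - y| <= d2 & forall j, x ord0 j = y ord0 j + t * r j x.
  by near: t.
(* Each generator is at most [t * (C * C) * Q] in absolute value, where [Q] will be the sum of all
   these absolute values. Summation gives Q <= Q / 2, hence Q = 0. *)
have tC : (size g)%:R * (C * C) * t <= 2^-1.
  near: t; apply: near_right_small; last by rewrite invr_gt0.
  by rewrite !mulr_ge0.
have Sx : ev S x != 0 by apply: Sd1; rewrite (le_trans xd) // ltW.
have xi : x ord0 i - y ord0 i = t.
  by rewrite xE addrC addKr /r /a' eqxx divff // mulr1.
have xG j : ev S x * (x ord0 j - y ord0 j) = (x ord0 i - y ord0 i) * ev (a' j) x.
  by rewrite xi xE addrC addKr /r mulrCA [ev S x * _]mulrC divfK //.
exists x; last first.
  by rewrite -subr_eq0 xi gt_eqF // (le_lt_trans xd).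
pose Q : R := \sum_(k < size g) `|ev g`_k x|.
have Q0 : 0 <= Q by apply: sumr_ge0.
have gk (k : 'I_(size g)) : `|ev g`_k x| <= t * (C * C) * Q.
  have -> : ev g`_k x = B (inr k) x * (t * \sum_l ev (b k l) x * ev g`_l x).
    by rewrite /B -xi -bP // evX mulrA mulVf ?mul1r // expf_neq0.
  rewrite normrM normrM (gtr0_norm t0).
  have -> : t * (C * C) * Q = C * (t * (C * Q)) by ring.
  apply: ler_pM => //; first by rewrite mulr_ge0 // ltW.
    exact: BC.
  rewrite ler_wpM2l ?(ltW t0) // (le_trans (ler_norm_sum _ _ _)) // mulr_sumr.
  apply: ler_sum => l _; rewrite normrM ler_wpM2r //.
  exact: (BC (inl (k, l))).
have Q_le : Q <= 2^-1 * Q.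
  apply: le_trans (ler_wpM2r Q0 tC); rewrite -mulrA -[leRHS]mulrA mulr_natl.
  apply: le_trans (ler_sum _ (fun k _ => gk k)) _.
  rewrite sumr_const card_ord le_eqVlt; apply/orP; left; apply/eqP.
  by congr (_ *+ _); ring.
have {}Q_eq0 : Q = 0 by apply/eqP; rewrite eq_le Q0 andbT; lra.
apply: vanishing_point => p Ip; have [c ->] := gspan p Ip.
rewrite /ev raddf_sum big1 // => k _ /=.
rewrite mevalM; apply/eqP; rewrite mulf_eq0; apply/orP; right.
rewrite -normr_eq0; move/eqP: Q_eq0; rewrite psumr_eq0 // => /allP/(_ k).
by rewrite mem_index_enum => /(_ isT).
Unshelve. all: by end_near. Qed.

End NotIsolated.
(** * Krull dimension and integral extensions *)

Section KrullDimension.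
Variable A : idomainType.
Implicit Types P Q : set A.

Definition set_pred P : {pred A} := fun a => `[< P a >].

Lemma prime_set_pred P : prime_set P -> prime_ideal (set_pred P).
Proof.
move=> [[P0 PD] P1 PM]; split; first split.
- exact/asboolP.
- exact/asboolP.
- by move=> a x y /asboolP Px /asboolP Py; apply/asboolP; apply: PD.
- by move=> x y /asboolP/PM[]Pz; apply/orP; [left | right]; apply/asboolP.
Qed.

Lemma prime_set0 : prime_set [set (0 : A)].
Proof.
split=> /=.
- by split=> // a x y -> ->; rewrite mulr0 addr0.
- by apply/eqP; rewrite oner_eq0.
- by move=> x y /eqP; rewrite mulf_eq0 => /orP[/eqP|/eqP]; [left | right].
Qed.

Lemma krull_dim_le1 : krull_dim_eq A 1 -> dim_le1 A.
Proof.
move=> [_ dim1] P Q x prP prQ Px sPQ; apply: contrapT => /not_orP[nQP x0].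
pose c (i : 'I_3) := if i == 0%N :> nat then [set (0 : A)] else if i == 1%N :> nat then P else Q.
suff /dim1 : prime_chain (fun i => set_pred (c i)) by [].
split=> [i|[[|[|[|i]]] // ip] [[|[|[|j]]] // jp] //= _].
- rewrite /c; case: ifP => _; first exact/prime_set_pred/prime_set0.
  by case: ifP => _; apply: prime_set_pred.
- split=> [a /asboolP /= ->|s]; first by apply/asboolP; case: prP => -[].
  by apply: x0; have /asboolP := s x (asboolT Px).
- split=> [a /asboolP /= ->|s]; first by apply/asboolP; case: prQ => -[].
  by apply: x0; have /asboolP := s x (asboolT (sPQ _ Px)).
- split=> [a /asboolP /= Pa|s]; first by apply/asboolP/sPQ.
  by apply: nQP => a Qa; have /asboolP := s a (asboolT Qa).
Qed.

(** Says that the curve is not reduced to a point: a nonzero nonunit is not a constant, so some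
    coordinate centred at a given point is nonzero. *)
Lemma krull_dim1_nonunit : krull_dim_eq A 1 ->
  exists x : A, x != 0 /\ forall y, y * x != 1.
Proof.
move=> [[P [prP sP]] _]; have [_ ns] := sP ord0 ord_max isT.
have [x Px nPx] : exists2 x, x \in P ord_max & x \notin P ord0.
  apply: contrapT => no; apply: ns => x Px; apply: contrapT => /negP nPx.
  by apply: no; exists x.
exists x; split=> [|y].
  by apply: contraNneq nPx => ->; have [[]] := prP ord0.
have [[P0 /negP P1 PD] _] := prP ord_max.
apply/eqP => yx; apply: P1; rewrite -yx -[y * x]addr0; exact: PD.
Qed.

End KrullDimension.

Section IntegralExtension.
Variables (A B : idomainType) (K : fieldType).
Variables (f : {rmorphism A -> K}) (g : {rmorphism B -> K}).
Hypothesis fg : forall a, exists b, f a = g b.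
Hypothesis gint : forall b, integralOver f (g b).

Hypothesis ginj : injective g.

(** Start from a monic [p] with p(b) in [P] and write p = q X + c. If [c] is in [P], then b q(b) is,
    hence q(b) is, and the degree drops. Otherwise [c] is the element sought, since c = p(b) - b
    q(b) lies in [Q]. The descent stops before p = 1 because 1 is not in [P]. *)
Lemma incomparability (P Q : set B) b : prime_set P -> ideal_set Q -> P `<=` Q ->
  Q b -> ~ P b -> exists a b', [/\ f a = g b', Q b' & ~ P b'].
Proof.
move=> [idP P1 PM] idQ sPQ Qb nPb; have [p pm /eqP pb] := gint b.
have {pb} : exists2 b', P b' & (map_poly f p).[g b] = g b'.
  by exists 0; rewrite ?pb ?rmorph0 //; case: idP.
elim/poly_ind: p pm => [|p c IHp] pm.
  by rewrite monicE lead_coef0 eq_sym oner_eq0 in pm.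
have [p0|p0] := eqVneq p 0.
  move=> [b' Pb']; rewrite p0 mul0r add0r map_polyC hornerC => gb'.
  have c1 : c = 1.
    by move: pm; rewrite p0 mul0r add0r monicE lead_coefC => /eqP.
  case: P1; suff <- : b' = 1 by [].
  by apply: ginj; rewrite -gb' /= c1 !rmorph1.
have {pm} {}/IHp IHp : p \is monic.
  move: pm; rewrite !monicE lead_coefDl ?lead_coefMX //.
  by rewrite size_mulX // (leq_ltn_trans (size_polyC_leq1 _)) // ltnS lt0n size_poly_eq0.
move=> [b' Pb']; rewrite rmorphD rmorphM /= map_polyX map_polyC hornerMXaddC.
have [d dE] : exists d, (map_poly f p).[g b] = g d.
  elim/poly_ind: (p) => [|q e [d dE]]; first by exists 0; rewrite !rmorph0 horner0.
  have [e' eE] := fg e; exists (d * b + e').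
  by rewrite rmorphD rmorphM /= map_polyX map_polyC hornerMXaddC dE /= eE rmorphD rmorphM.
have [c' cE] := fg c; rewrite dE /= cE -rmorphM -rmorphD => /ginj b'E.
rewrite -b'E in Pb'.
have [Pc'|nPc'] := pselect (P c').
  apply: IHp; exists d => //.
  have /PM[//|//] : P (d * b).
  by have := idealB idP Pb' Pc'; rewrite addrK.
exists c, c'; split=> //.
by have := idealB idQ (sPQ _ Pb') (idealMl d idQ Qb); rewrite addrAC subrr add0r.
Qed.

(** Primes are contracted to [A]. Incomparability serves twice: from 0 to [P], to see that the
    contraction of [P] is nonzero, and from [P] to [Q], to see that the contractions differ. *)
Lemma integral_dim_le1 : dim_le1 A -> dim_le1 B.
Proof.
move=> dimA P Q x prP prQ Px sPQ; apply: contrapT => /not_orP[nQP x0].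
pose c (I : set B) := [set a | exists2 b, I b & f a = g b].
have prc I : prime_set I -> prime_set (c I).
  move=> [idI I1 IM]; split=> [||a a'].
  - split; first by exists 0; rewrite ?rmorph0 //; case: idI.
    move=> a u v [u' Iu' uE] [v' Iv' vE]; have [a' aE] := fg a.
    exists (a' * u' + v'); first by apply idI.2.
    by rewrite !rmorphD !rmorphM aE uE vE.
  - move=> [b Ib /eqP]; rewrite rmorph1 -(rmorph1 g) => /eqP/ginj b1.
    by apply: I1; rewrite b1.
  - have [[b bE] [b' b'E]] := (fg a, fg a').
    move=> [d Id]; rewrite rmorphM bE b'E -rmorphM => /ginj dE.
    by move: Id; rewrite -dE => /IM[]; [left; exists b | right; exists b'].
have scPQ : c P `<=` c Q by move=> a [b Pb aE]; exists b => //; apply: sPQ.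
have [a [b [aE Pb /= b0]]] :
    exists a b, [/\ f a = g b, P b & ~ [set (0 : B)] b].
  apply: (@incomparability [set 0] P x) => //; first exact: prime_set0.
    by case: prP.
  by move=> _ ->; case: prP => -[].
have ca : c P a by exists b.
have [sQP|a0] := dimA (c P) (c Q) a (prc P prP) (prc Q prQ) ca scPQ; last first.
  by apply: b0; apply: ginj; rewrite -aE a0 !rmorph0.
apply: nQP => z Qz; apply: contrapT => nPz.
have [idQ _ _] := prQ.
have [a' [z' [a'E Qz' nPz']]] := incomparability prP idQ sPQ Qz nPz.
have [|z'' Pz''] := sQP a'; first by exists z'.
by rewrite a'E => /ginj z'E; apply: nPz'; rewrite z'E.
Qed.

End IntegralExtension.
(** * Regularity of local rings *)

Section RegularLocalRing.
Variables (R : realType) (n : nat) (X : irr_algset R n).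
Implicit Type x : X.

Lemma point_in x : irr_set X (\val x).
Proof. by apply: set_mem; exact: (valP x). Qed.

Lemma regular_atP x z : z \in regular_at x <-> exists v, hasval (\val x) z v.
Proof.
split=> [/localizationP[a [s [sx ->]]]|[v [a [s [sx -> _]]]]].
  by exists (peval a (\val x) / peval s (\val x)), a, s.
by apply/localizationP; exists a, s.
Qed.

Lemma to_local_subproof x (a : polyfun X) : frac a \in regular_at x.
Proof.
apply/regular_atP; exists (peval a (\val x)).
exact: hasval_frac (point_in x) a.
Qed.

Definition to_local x (a : polyfun X) : local_ring x :=
  Sub (frac a) (to_local_subproof x a).

Fact to_local_zmod x : zmod_morphism (to_local x).
Proof. by move=> a b; apply: val_inj; rewrite /= tofracB. Qed.

Fact to_local_monoid x : monoid_morphism (to_local x).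
Proof.
by split=> [|a b]; apply: val_inj; rewrite /= ?tofrac1 ?tofracM.
Qed.

HB.instance Definition _ x := GRing.isZmodMorphism.Build _ _ (to_local x) (to_local_zmod x).
HB.instance Definition _ x := GRing.isMonoidMorphism.Build _ _ (to_local x) (to_local_monoid x).

Section AtPoint.
Variable x : X.
Local Notation L := (local_ring x).
Local Notation xv := (\val x : 'rV[R]_n).
Local Notation Xx := (point_in x).

Lemma val_hasval (z : L) : exists v, hasval xv (\val z) v.
Proof. exact/regular_atP/(valP z). Qed.

Lemma local_sub z v : hasval xv z v -> exists w : L, \val w = z.
Proof.
move=> zv; have zr : z \in regular_at x by apply/regular_atP; exists v.
by exists (Sub z zr).
Qed.

Lemma local_frac (z : L) : exists a (s s' : L),
  [/\ z = s * to_local x a, to_local x a = s' * z & s * s' = 1].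
Proof.
have [v [a [s [sx zE _]]]] := val_hasval z.
have sv : hasval xv (frac s)^-1 (peval s xv)^-1 by exact: (hasvalV (hasval_frac Xx s) sx).
have [s' s'E] := local_sub sv; exists a, s', (to_local x s).
have s0 := den_neq0 Xx sx.
split; apply: val_inj => /=; rewrite ?s'E.
- by rewrite zE mulrC.
- by rewrite zE mulrC divfK.
- by rewrite mulVf.
Qed.

Lemma noetherian_local : noetherian_ring L.
Proof.
apply: (noetherian_transfer (f := to_local x)); first exact: noetherian_polyfun.
by move=> z; have [a [s [s' [zE aE _]]]] := local_frac z; exists a, s, s'.
Qed.

Definition local_max : {pred L} := fun z => `[< hasval xv (\val z) 0 >].

Lemma local_max_unit (z : L) : z \notin local_max -> exists w, w * z = 1.
Proof.
move=> /asboolPn nz; have [v zv] := val_hasval z.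
have v0 : v != 0 by apply: contra_notN nz => /eqP <-.
have [w wE] := local_sub (hasvalV zv v0); exists w; apply: val_inj.
rewrite /= wE mulVf //; apply: contra v0 => /eqP z0.
by apply/eqP; apply: (hasval_inj Xx zv); rewrite z0; exact: hasval0 Xx.
Qed.

Lemma local_max_ideal : idealr_closed local_max.
Proof.
split.
- by apply/asboolP; exact: hasval0 Xx.
- apply/asboolP => /(hasval_inj Xx (hasval1 Xx))/eqP.
  by rewrite oner_eq0.
- move=> a z w /asboolP z0 /asboolP w0; apply/asboolP.
  have [v av] := val_hasval a.
  have := hasvalD Xx (hasvalM Xx av z0) w0.
  by rewrite mulr0 addr0.
Qed.

Lemma ideal_sub_local_max (J : {pred L}) : idealr_closed J -> {subset J <= local_max}.
Proof.
move=> [J0 /negP J1 JD] z Jz; apply: contrapT => /negP/local_max_unit[w wz].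
apply: J1; rewrite -wz -[w * z]addr0; exact: JD.
Qed.

Lemma regular_point : dim_le1 (polyfun X) ->
  (exists2 t : ratfun X, t != 0 & uniformizer xv t) -> regular_local_ring L.
Proof.
move=> dimX [t t0 [_ tv tgen]].
have maxI : maximal_ideal local_max.
  by split=> [|J idJ _]; [exact: local_max_ideal | exact: ideal_sub_local_max].
split.
  move=> I [I0 _ ID].
  have [|s [sI sgen]] := @noetherian_span _ [set z | z \in I] noetherian_local.
    by split=> // a z w Iz Iw; apply: ID.
  exists (size s), (fun i => s`_i) => a; split=> [/sgen//|[c ->]].
  apply: (@ideal_sum _ [set z | z \in I]) => [|i _].
    by split=> // b z w Iz Iw; apply: ID.
  rewrite /= -[_ * _]addr0; apply: ID => //; apply: sI.
  by rewrite mem_nth.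
exists local_max; split=> //.
  move=> J [idJ maxJ] z; apply/idP/idP; first exact: ideal_sub_local_max.
  apply: maxJ; first exact: local_max_ideal.
  exact: ideal_sub_local_max.
have [tl tlE] := local_sub tv.
exists 1%N, (fun=> tl); split; last first.
  move=> a; split=> [/asboolP/tgen[w [u [wu aE]]]|[c ->]].
    have [wl wlE] := local_sub wu; exists (fun=> wl).
    by rewrite big_ord1; apply: val_inj; rewrite /= wlE tlE mulrC.
  rewrite big_ord1; have [cv cvP] := val_hasval (c ord0).
  by apply/asboolP; rewrite /= tlE; have := hasvalM Xx cvP tv; rewrite mulr0.
split.
  exists (fun i : 'I_2 => if i == 0%N :> nat then (pred1 (0 : L) : {pred L}) else local_max).
  split=> [i|[[|[|i]] // ip] [[|[|j]] // jp] //= _].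
    case: ifP => _; last first.
      split; first exact: local_max_ideal.
      move=> z w /asboolP zw; have [v zv] := val_hasval z; have [u wu] := val_hasval w.
      have /esym/eqP := hasval_inj Xx zw (hasvalM Xx zv wu).
      rewrite mulf_eq0 => /orP[]/eqP e0; apply/orP; [left|right]; apply/asboolP.
        by rewrite -e0.
      by rewrite -e0.
    split; first split.
    - by rewrite inE.
    - by rewrite inE oner_eq0.
    - by move=> a z w /eqP -> /eqP ->; rewrite inE mulr0 addr0.
    - move=> z w; rewrite !inE => /eqP zw; rewrite -!(inj_eq val_inj).
      have : \val z * \val w == 0 by apply/eqP; exact: (congr1 val zw).
      by rewrite mulf_eq0.
  split=> [z /eqP ->|s]; first by have [] := local_max_ideal.
  have /s : tl \in local_max by apply/asboolP; rewrite tlE.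
  by rewrite inE -(inj_eq val_inj) tlE (negPf t0).
(* Given three primes in a chain, the last two contract to nonzero primes of the polynomial
   functions, which coincide by the dimension bound. The primes then coincide too, every element
   being a unit times a polynomial function. *)
move=> e P [prP sP]; rewrite leqNgt; apply/negP => e2.
pose c (i : 'I_e.+1) := [set a | to_local x a \in P i].
have prc i : prime_set (c i).
  have [[P0 /negP P1 PD] PM] := prP i; split; rewrite /c /=.
  - split=> /=; first by rewrite rmorph0.
    by move=> a u v Pu Pv; rewrite rmorphD rmorphM; apply: PD.
  - by rewrite rmorph1.
  - by move=> a b; rewrite rmorphM => /PM/orP.
have PMl i a z : z \in P i -> a * z \in P i.
  have [[P0 _ PD] _] := prP i.
  by move=> Pz; rewrite -[_ * _]addr0; apply: PD.
pose i1 : 'I_e.+1 := Ordinal (ltnW e2 : (1 < e.+1)%N).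
pose i2 : 'I_e.+1 := Ordinal (e2 : (2 < e.+1)%N).
have [_ n01] := sP ord0 i1 isT; have [s12 n12] := sP i1 i2 isT.
have [z Pz nPz] : exists2 z, z \in P i1 & z \notin P ord0.
  apply: contrapT => no; apply: n01 => z Pz; apply: contrapT => /negP nPz.
  by apply: no; exists z.
have [a [s [s' [zE aE _]]]] := local_frac z.
have Pa : c i1 a by rewrite /c /= aE; apply: PMl.
have [c21|a0] := dimX (c i1) (c i2) a (prc i1) (prc i2) Pa (fun b => s12 _).
  apply: n12 => w Pw; have [b [r [r' [wE bE _]]]] := local_frac w.
  rewrite wE; apply: (PMl); apply: c21; rewrite /c /= bE; exact: PMl.
move/negP: nPz; apply; rewrite zE a0 rmorph0 mulr0.
by have [[]] := prP ord0.
Qed.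

End AtPoint.
End RegularLocalRing.
(** * The normalization of a curve *)

Section CurveNormalization.
Variables (R : realType) (m n : nat) (X : irr_algset R n) (X' : irr_algset R m).
Variables (pi' : n.-tuple (mpoly m R)) (iota : {rmorphism ratfun X' -> ratfun X}).
Hypothesis curveX : is_curve X.
Hypothesis normX : is_normalization pi' iota.

Local Notation emb := (iota \o @FracField.tofrac (polyfun X')).

Lemma polymap_in y : irr_set X' y -> irr_set X (polymap pi' y).
Proof. by case: normX => h _ _; apply: h. Qed.

Lemma iota_comp p :
  iota (frac (polyclass X' (comp_mpoly pi' p))) = frac (polyclass X p).
Proof. by case: normX. Qed.

Lemma integral_iota z :
  integralOver (@FracField.tofrac (polyfun X)) z <->
  exists f : polyfun X', z = iota (frac f).
Proof. by case: normX. Qed.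

Lemma iota_inj : injective iota.
Proof. exact: fmorph_inj. Qed.

Lemma emb_inj : injective emb.
Proof. by move=> f g /iota_inj/eqP; rewrite tofrac_eq => /eqP. Qed.

Definition pullback (f : polyfun X) : polyfun X' :=
  polyclass X' (comp_mpoly pi' (repr f)).

Lemma iota_pullback f : iota (frac (pullback f)) = frac f.
Proof. by rewrite iota_comp polyclass_repr. Qed.

Lemma pullback_eq0 f : (pullback f == 0) = (f == 0).
Proof.
rewrite -[RHS]tofrac_eq0 -iota_pullback fmorph_eq0.
by rewrite tofrac_eq0.
Qed.

Lemma ev_comp p y : ev (comp_mpoly pi' p) y = ev p (polymap pi' y).
Proof.
by rewrite /ev comp_mpoly_meval; apply: meval_eq => i; rewrite mxE.
Qed.

Lemma peval_pullback f y : irr_set X' y -> peval (pullback f) y = peval f (polymap pi' y).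
Proof. by move=> Yy; rewrite /pullback peval_polyclass // ev_comp. Qed.

Lemma iota_surj z : exists g, iota g = z.
Proof.
have [a [s [_ ->]]] := fraction_rep z.
by exists (frac (pullback a) / frac (pullback s)); rewrite fmorph_div !iota_pullback.
Qed.

Lemma dim_le1_base : dim_le1 (polyfun X).
Proof. exact: krull_dim_le1 curveX. Qed.

Lemma dim_le1_normalization : dim_le1 (polyfun X').
Proof.
apply: (@integral_dim_le1 _ _ _ (@FracField.tofrac (polyfun X)) emb).
- by move=> a; exists (pullback a); rewrite /= iota_pullback.
- by move=> b; apply/integral_iota; exists b.
- exact: emb_inj.
- exact: dim_le1_base.
Qed.

Lemma iota_const c : iota (frac (polyclass X' (mpolyC m c))) = frac (polyclass X (mpolyC n c)).
Proof. by rewrite -iota_comp comp_mpolyC. Qed.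

Lemma nonconstant (f : polyfun X) c : f != 0 -> (forall g, g * f != 1) ->
  f <> polyclass X (mpolyC n c).
Proof.
move=> f0 nu fE; have [c0|c0] := eqVneq c 0.
  by move: f0; rewrite fE c0 mpolyC0 polyclass0 eqxx.
have /eqP := nu (polyclass X (mpolyC n c^-1)); apply.
by rewrite fE -polyclassM -mpolyCM mulVf // mpolyC1 polyclass1.
Qed.

Lemma coordinate_neq0_base x : irr_set X x -> exists i, coordinate X i x != 0.
Proof.
move=> Xx; have [f [f0 nu]] := krull_dim1_nonunit curveX.
apply: contrapT => all0; have [c fE] := coordinate_span f Xx.
apply: (nonconstant f0 nu (c := peval f x)); rewrite {1}fE big1 ?addr0 // => i _.
have /eqP -> : coordinate X i x == 0 by apply: contrapT => /negP i0; apply: all0; exists i.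
by rewrite mulr0.
Qed.

Lemma coordinate_neq0_normalization y : irr_set X' y -> exists i, coordinate X' i y != 0.
Proof.
move=> Yy; have [f [f0 nu]] := krull_dim1_nonunit curveX.
apply: contrapT => all0; have [c fE] := coordinate_span (pullback f) Yy.
apply: (nonconstant f0 nu (c := peval (pullback f) y)).
apply/eqP; rewrite -tofrac_eq -iota_pullback -iota_const {1}fE big1 ?addr0 // => i _.
have /eqP -> : coordinate X' i y == 0 by apply: contrapT => /negP i0; apply: all0; exists i.
by rewrite mulr0.
Qed.

(** Transitivity of integrality: the coefficients of an equation over P(X') are integral over P(X),
    hence so is [z], which therefore already belongs to P(X'). *)
Lemma locally_normal_normalization y : irr_set X' y -> @locally_normal _ _ X' y.
Proof.
move=> Yy z [p pm pz].
have [f zE] : exists f : polyfun X', iota z = iota (frac f).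
  apply/integral_iota; apply: (@integral_root_monic _ _ _ _ (map_poly emb p)).
  - exact: monic_map.
  - by rewrite map_poly_comp fmorph_root.
  - move=> w /(nthP 0)[i _ <-]; rewrite coef_map /=.
    by apply/integral_iota; exists p`_i.
exists (peval f y); rewrite (iota_inj zE); exact: hasval_frac.
Qed.

Lemma uniformizer_normalization y : irr_set X' y ->
  exists i, uniformizer y (frac (coordinate X' i y)).
Proof.
move=> Yy; apply: uniformizer_exists => //.
- exact: dim_le1_normalization.
- exact: locally_normal_normalization.
- exact: coordinate_neq0_normalization.
Qed.

Lemma exists_denominator : exists (c : polyfun X) (a : 'I_m -> polyfun X),
  c != 0 /\ forall j, frac c * iota (frac (polyclass X' (mpolyX R (mnm1 j)))) = frac (a j).
Proof.
have /choice[a /choice[s asP]] : forall j : 'I_m, exists a s : polyfun X,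
    s != 0 /\ iota (frac (polyclass X' (mpolyX R (mnm1 j)))) = frac a / frac s.
  by move=> j; exact: fraction_rep.
exists (\prod_j s j), (fun j => (\prod_(k | k != j) s k) * a j); split.
  by apply/prodf_neq0 => j _; have [] := asP j.
move=> j; have [s0 ->] := asP j; rewrite (bigD1 j) //= !tofracM mulrC mulrA.
by rewrite divfK ?tofrac_eq0 // mulrC.
Qed.

Section Denominator.
Variables (c : polyfun X) (a : 'I_m -> polyfun X).
Hypothesis c0 : c != 0.
Hypothesis caE : forall j,
  frac c * iota (frac (polyclass X' (mpolyX R (mnm1 j)))) = frac (a j).

(** The rational inverse of [polymap pi'], meaningful where [c] does not vanish: it lifts every such
    real point of X to a real point of X'. *)
Definition section_map (x : 'rV[R]_n) : 'rV[R]_m := \row_j (peval (a j) x / peval c x).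

Section At.
Variable x : 'rV[R]_n.
Hypothesis Xx : irr_set X x.
Hypothesis cx : peval c x != 0.

Lemma hasval_iota_poly p : hasval x (iota (frac (polyclass X' p))) (ev p (section_map x)).
Proof.
elim/mpoly_ring_ind: p => [d|j|p q hp hq|p q hp hq].
- rewrite iota_const /ev mevalC -[d in X in hasval _ _ X](mevalC (fun i => x ord0 i)).
  have := hasval_frac Xx (polyclass X (mpolyC n d)).
  by rewrite peval_polyclass.
- rewrite /ev mevalXU mxE; exists (a j), c; split=> //.
  by rewrite -caE mulrC mulKf // tofrac_eq0.
- rewrite polyclassD tofracD rmorphD /ev mevalD; exact: hasvalD.
- rewrite polyclassM tofracM rmorphM /ev mevalM; exact: hasvalM.
Qed.

Lemma hasval_iota f : hasval x (iota (frac f)) (peval f (section_map x)).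
Proof. by rewrite -{1}[f]polyclass_repr; exact: hasval_iota_poly. Qed.

Lemma section_in : irr_set X' (section_map x).
Proof.
apply: vanishing_point => p /vanishingP p0.
have := hasval_iota_poly p; rewrite (_ : polyclass X' p = 0); last first.
  exact/polyclass_eq0.
by rewrite tofrac0 rmorph0 => /(hasval_inj Xx (hasval0 Xx)).
Qed.

Lemma polymap_section : polymap pi' (section_map x) = x.
Proof.
apply/rowP => i; rewrite mxE.
have := hasval_frac Xx (polyclass X (mpolyX R (mnm1 i))).
rewrite -iota_comp comp_mpolyXU => /(hasval_inj Xx (hasval_iota_poly _)).
by rewrite -tnth_nth peval_polyclass // /ev mevalXU.
Qed.

(* Where [c] does not vanish, the local ring of [X] contains the coordinates of
   [X'], hence all elements integral over the polynomial functions of [X]. *)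
Lemma regular_off_denominator : nonsingular X x.
Proof.
exists (SigSub (mem_set Xx)) => //=.
apply: regular_point; first exact: dim_le1_base.
have [|i ut] := uniformizer_exists Xx dim_le1_base _ (coordinate_neq0_base Xx).
  move=> z /integral_iota[f ->]; exists (peval f (section_map x)).
  exact: hasval_iota.
by exists (frac (coordinate X i x)) => //; case: ut.
Qed.

End At.
End Denominator.
End CurveNormalization.
(** * Integral elements are regular *)

Lemma near_right_ex (R : realType) (P : R -> Prop) :
  (\forall d \near 0^'+, P d) -> exists d, 0 < d /\ P d.
Proof.
move=> nP; near (0 : R)^'+ => d; exists d; split; near: d => //.
exact: nbhs_right_gt.
Unshelve. all: by end_near. Qed.

Lemma nbhs_rV_normP (R : realType) n (x : 'rV[R]_n) (P : set 'rV[R]_n) :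
  nbhs x P <-> exists2 e, 0 < e & forall z, `|z - x| < e -> P z.
Proof.
split=> [/nbhs_normP[e /= e0 xP]|[e e0 xP]].
  by exists e => // z zx; apply: xP; rewrite /ball_ /= distrC.
apply: (nbhs_normP x P).2; exists e => // z /=.
by rewrite distrC => /xP.
Qed.

Lemma continuous_ev (R : realType) n (p : mpoly n R) : continuous (ev p).
Proof.
move=> x; apply: (@cvgrPdist_le _ _ _ _ (nbhs_filter x) (ev p) (ev p x)).2 => e e0.
have [d [d0 pd]] := near_right_ex (lipschitz_near_cont (lipschitz_near_ev x p) e0).
apply/nbhs_rV_normP; exists d => // z zx.
by rewrite distrC; apply: pd; exact: ltW.
Qed.

Section PolynomialMapContinuity.
Variables (R : realType) (m n : nat) (pi' : n.-tuple (mpoly m R)).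

Lemma polymap_cont y e : 0 < e ->
  \forall d \near 0^'+, forall y', `|y' - y| <= d ->
    `|polymap pi' y' - polymap pi' y| <= e.
Proof.
move=> e0; near=> d.
have pd : forall i y', `|y' - y| <= d ->
    `|ev (tnth pi' i) y' - ev (tnth pi' i) y| <= e.
  near: d; apply: filter_forall => i; apply: lipschitz_near_cont => //.
  exact: lipschitz_near_ev.
by move=> y' y'd; apply: norm_le_coord => [|i]; [exact: ltW | rewrite !mxE pd].
Unshelve. all: by end_near. Qed.

End PolynomialMapContinuity.

Section LocalToGlobal.
Variables (R : realType) (n : nat) (Y : irr_algset R n).
Local Notation A := (polyfun Y).

(* A rational function that is regular at every point is a global quotient,
   whose denominator is a sum of squares of local denominators. *)
Lemma regular_functionsP (g : ratfun Y) :
  g \in regular_functions Y <-> forall y, irr_set Y y -> exists v, hasval y g v.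
Proof.
split=> [/localizationP[a [s [/asboolP sY ->]]] y Yy|gY].
  by exists (peval a y / peval s y), a, s; split=> //; apply/eqP; exact: sY.
(* The ideal of denominators of [g] has no common zero on [Y]. Over the reals the sum of squares of
   its generators vanishes only at a common zero, hence nowhere. *)
pose D := [set s : A | exists a, frac s * g = frac a].
have idD : ideal_set D.
  split; first by exists 0; rewrite tofrac0 mul0r.
  move=> b s s' [a aE] [a' a'E]; exists (b * a + a').
  by rewrite !tofracD !tofracM mulrDl -mulrA aE a'E.
have [s [sD sgen]] := noetherian_span (@noetherian_polyfun R n Y) idD.
have /choice[a aE] : forall i : 'I_(size s), exists a, frac s`_i * g = frac a.
  by move=> i; apply: sD; rewrite mem_nth.
pose sigma := \sum_(i < size s) s`_i ^+ 2.
have sigma_pos y : irr_set Y y -> peval sigma y != 0.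
  move=> Yy; have [v [b [r [ry gE _]]]] := gY y Yy.
  have [|c rE] := sgen r.
    by exists b; rewrite gE mulrC divfK // (den_neq0 Yy).
  rewrite peval_sum //; apply: contra ry => /eqP sum0.
  have s0 (i : 'I_(size s)) : peval s`_i y = 0.
    apply/eqP; rewrite -sqrf_eq0; move/eqP: sum0.
    rewrite psumr_eq0 => [/allP/(_ i)|j _]; last by rewrite pevalX // sqr_ge0.
    by rewrite mem_index_enum pevalX // => /(_ isT).
  by rewrite rE peval_sum // big1 // => i _; rewrite pevalM // s0 mulr0.
apply/localizationP; exists (\sum_(i < size s) s`_i * a i), sigma; split.
  by apply/asboolP => y /sigma_pos/eqP.
have [y Yy] := (irr_irreducible Y).1.
have sigma0 := den_neq0 Yy (sigma_pos y Yy).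
apply: (mulfI sigma0); rewrite [RHS]mulrC divfK // !rmorph_sum mulr_suml.
by apply: eq_bigr => i _ /=; rewrite expr2 !tofracM -mulrA aE.
Qed.

(** Density holds because P(Y) is a domain: if [p] vanishes wherever [h] does not, then p h = 0. *)
Lemma zariski_open_dense (h : A) : h != 0 ->
  let U := irr_set Y `\` [set x | ev (repr h) x = 0] in
  zariski_open Y U /\ zariski_dense Y U.
Proof.
move=> h0 U; split.
  exists [set x | ev (repr h) x = 0] => //.
  exists [set repr h]; apply/seteqP; split=> x /=; first by move=> ? _ ->.
  exact.
move=> Z [S ->] sUZ x Yx p Sp.
have : polyclass Y p * h = 0.
  apply/polyfun_eqP => z Yz; rewrite pevalM // peval0 // peval_polyclass //.
  have [hz|hz] := pselect (ev (repr h) z = 0); first by rewrite [peval h z]hz mulr0.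
  by rewrite (sUZ z) ?mul0r.
move/eqP; rewrite mulf_eq0 (negPf h0) orbF => /eqP/polyclass_eq0; exact.
Qed.

End LocalToGlobal.

(** Cauchy's bound: when |v| > 1, the equation is divided by the power of |v| just below the top
    one. *)
Lemma monic_root_bound (R : realFieldType) (c : nat -> R) d (v : R) : c d = 1 ->
  \sum_(i < d.+1) c i * v ^+ i = 0 -> `|v| <= 1 + \sum_(i < d) `|c i|.
Proof.
move=> cd; rewrite big_ord_recr /= cd mul1r => /eqP.
have S0 : 0 <= \sum_(i < d) `|c i| by apply: sumr_ge0.
have [v1|v1] := leP `|v| 1; first by move=> _; rewrite (le_trans v1) // lerDl.
rewrite addrC addr_eq0 => /eqP vd; case: d => [|d] in cd vd S0 *.
  by move: vd; rewrite big_ord0 oppr0 expr0 => /eqP; rewrite oner_eq0.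
have vd0 : 0 < `|v| ^+ d by rewrite exprn_gt0 // (lt_trans _ v1).
apply: (@le_trans _ _ (\sum_(i < d.+1) `|c i|)); last by rewrite lerDr.
rewrite -(ler_pM2r vd0) -exprS -normrX vd normrN (le_trans (ler_norm_sum _ _ _)) //.
rewrite mulr_suml; apply: ler_sum => i _; rewrite normrM normrX ler_wpM2l //.
by apply: ler_weXn2l; [exact: ltW | rewrite -ltnS].
Qed.

Section CentralLocus.
Variables (R : realType) (m n : nat) (X : irr_algset R n) (X' : irr_algset R m).
Variables (pi' : n.-tuple (mpoly m R)) (iota : {rmorphism ratfun X' -> ratfun X}).
Hypothesis curveX : is_curve X.
Hypothesis normX : is_normalization pi' iota.

(** Locally [h] is a unit times a power of the uniformizing coordinate, so it is nonzero at points
    near [y] whose coordinate differs from that of [y]; [not_isolated] supplies them. *)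
Lemma nonzero_nearby (h : polyfun X') y e : h != 0 -> irr_set X' y -> 0 < e ->
  exists2 x, irr_set X' x & `|x - y| < e /\ peval h x != 0.
Proof.
move=> h0 Yy e0; have [i ut] := uniformizer_normalization curveX normX Yy.
have [|k [w [u [[a [s [sy wE uE]]] u0 hE]]]] :=
    unif_decomp Yy ut (dim_le1_normalization curveX normX) _ (hasval_frac Yy h).
  by rewrite tofrac_eq0.
have ay : peval a y != 0 by apply: contra u0 => /eqP a0; rewrite uE a0 mul0r.
have shE : s * h = coordinate X' i y ^+ k * a.
  apply/eqP; rewrite -tofrac_eq !tofracM tofracXn hE wE.
  by rewrite mulrCA [frac s * _]mulrC divfK // (den_neq0 Yy).
have ly : 0 < `|peval a y| / 2 by rewrite divr_gt0 // normr_gt0.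
have [d [d0 ad]] := near_right_ex (lipschitz_near_cont (lipschitz_near_ev y (repr a)) ly).
have [|x Xx [xi xy]] := not_isolated Yy ut (e := Num.min e d).
  by rewrite lt_min e0.
exists x => //; move: xy; rewrite lt_min => /andP[xe xd]; split=> //.
have ax : peval a x != 0.
  have := ad x (ltW xd); apply: contraTneq => a0.
  rewrite -/(peval a x) a0 sub0r normrN -ltNge -/(peval a y).
  by rewrite ltr_pdivrMr // ltr_pMr ?normr_gt0 // ltr1n.
have : peval (s * h) x != 0.
  by rewrite shE pevalM // pevalX // peval_coordinate // mulf_neq0 // expf_neq0 // subr_eq0.
by rewrite pevalM // mulf_eq0 negb_or => /andP[].
Qed.

Lemma central_image y : irr_set X' y -> Cent X (polymap pi' y).
Proof.
move=> Yy; split; first exact: (polymap_in normX).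
move=> B /nbhs_rV_normP[e e0 xB].
have [c [a [c0 caE]]] := exists_denominator iota.
have e20 : 0 < e / 2 by rewrite divr_gt0.
have [d [d0 pd]] := near_right_ex (polymap_cont pi' y e20).
have pc0 : pullback X' pi' c != 0 by rewrite (pullback_eq0 normX).
have [y' Yy' [y'd cy']] := nonzero_nearby pc0 Yy d0.
have Xy' := polymap_in normX Yy'.
exists (polymap pi' y'); split.
  apply: (regular_off_denominator curveX normX c0 caE Xy').
  by rewrite -(@peval_pullback _ _ _ X X' pi').
apply: xB; apply: le_lt_trans (pd _ (ltW y'd)) _.
by rewrite ltr_pdivrMr // ltr_pMr // ltr1n.
Qed.

(* A pole of [g] at [y] would make the continuous function blow up along the
   images of points of [X'] tending to [y]. *)
Lemma cont_rational_regular g y : iota g \in cont_rational X -> irr_set X' y ->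
  exists v, hasval y g v.
Proof.
move=> /asboolP[f [p [q [cf [U [[Z [T ZE] UE] dU qU fU]] zE]]]] Yy.
have nq : frac (polyclass X q) != 0.
  apply: (represents_den_neq0 (f := f) (p := p)); exists U; split=> //.
  by exists Z => //; exists T.
have [i ut] := uniformizer_normalization curveX normX Yy.
have dim' := dim_le1_normalization curveX normX.
have [//|gV] := valuation_ring Yy ut dim' g.
have [->|g0] := eqVneq g 0; first by exists 0; exact: hasval0.
have [b [s [sy gVE /esym/eqP]]] := gV.
rewrite mulf_eq0 invr_eq0 (negPf sy) orbF => /eqP b0; exfalso.
have bn0 : b != 0.
  by apply: contra g0 => /eqP bE; rewrite -invr_eq0 gVE bE tofrac0 mul0r.
have gE : g = frac s / frac b by rewrite -[g]invrK gVE invf_div.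
(* An equation of the complement of [U] that is not identically zero on X: otherwise [U] would be
   empty, against density. *)
have [t Tt tX] : exists2 t, T t & polyclass X t != 0.
  apply: contrapT => no; have [x Xx] := (irr_irreducible X).1.
  have TX r z : T r -> irr_set X z -> ev r z = 0.
    move=> Tr; apply: (polyclass_eq0 X r).1; apply/eqP; apply: contrapT => /negP r0.
    by apply: no; exists r.
  have a1 : algebraic [set z : 'rV[R]_n | forall r, [set 1] r -> ev r z = 0].
    by exists [set 1].
  have sU : U `<=` [set z | forall r, [set 1] r -> ev r z = 0].
    by move=> z; rewrite UE ZE => -[Xz nz]; case: nz => r Tr; exact: TX.
  have /eqP := dU _ a1 sU x Xx 1 erefl.
  by rewrite /ev meval1 oner_eq0.
have [c [a [c0 caE]]] := exists_denominator iota.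
(* Where [h] is nonzero, the image lies in [U] and the denominator [b] of [g] does not vanish. *)
pose h := pullback X' pi' (polyclass X t * c) * b.
have h0 : h != 0 by rewrite mulf_neq0 // (pullback_eq0 normX) mulf_neq0.
have Cy := central_image Yy.
have [e e0 fe] : exists2 e, 0 < e & forall x, `|x - polymap pi' y| < e ->
    Cent X x -> `|f (polymap pi' y) - f x| <= 1.
  have := (subspace_continuousP _ _).1 cf _ Cy.
  move=> /cvgrPdist_le/(_ _ ltr01); rewrite near_withinE => /nbhs_rV_normP[e e0 xP].
  by exists e.
pose M := `|f (polymap pi' y)| + 1; have M0 : 0 < M by rewrite ltr_wpDl.
have sy0 : 0 < `|peval s y| / 2 by rewrite divr_gt0 // normr_gt0.
(* Chosen to contradict |f| <= M near the image of [y]: there |s| stays above |s(y)| / 2 and |b|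
   below |s(y)| / 2 / (M + 1), so that |s / b| exceeds [M]. *)
have sM0 : 0 < `|peval s y| / 2 / (M + 1) by rewrite divr_gt0 // ltr_wpDl // ltW.
have e20 : 0 < e / 2 by rewrite divr_gt0.
have [d [d0 [[sd bd] pd]]] := near_right_ex (filterI (filterI
  (lipschitz_near_cont (lipschitz_near_ev y (repr s)) sy0)
  (lipschitz_near_cont (lipschitz_near_ev y (repr b)) sM0)) (polymap_cont pi' y e20)).
have [x Xx [xd]] := nonzero_nearby h0 Yy d0.
have xd' := ltW xd.
rewrite pevalM // (@peval_pullback _ _ _ X X' pi') // pevalM; last exact: (polymap_in normX).
rewrite !mulf_eq0 !negb_or => /andP[/andP[tx cx] bx].
have Xpx := polymap_in normX Xx.
have Cx : Cent X (polymap pi' x) by exact: central_image.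
have Ux : U (polymap pi' x).
  rewrite UE; split=> //; rewrite ZE => /(_ t Tt) tx0.
  by move: tx; rewrite peval_polyclass // tx0 eqxx.
have sbE : frac s / frac b =
    frac (pullback X' pi' (polyclass X p)) / frac (pullback X' pi' (polyclass X q)).
  by apply: (fmorph_inj iota); rewrite -gE zE fmorph_div !(iota_pullback normX).
have fb0 : frac b != 0 :> ratfun X' by rewrite tofrac_eq0.
have fq0 : frac (pullback X' pi' (polyclass X q)) != 0 :> ratfun X'.
  by rewrite tofrac_eq0 (pullback_eq0 normX) -tofrac_eq0.
have cross : s * pullback X' pi' (polyclass X q) = pullback X' pi' (polyclass X p) * b.
  by apply/eqP; rewrite -tofrac_eq !tofracM -(eqr_div _ _ fb0 fq0) sbE.
have fx : f (polymap pi' x) = peval s x / peval b x.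
  have qx : ev q (polymap pi' x) != 0 by apply/eqP; exact: qU.
  rewrite fU //; apply/eqP; rewrite eqr_div //.
  rewrite -(peval_polyclass q Xpx) -(peval_polyclass p Xpx) -!(@peval_pullback _ _ _ X X' pi') //.
  by rewrite -!pevalM // cross.
have : `|f (polymap pi' x)| <= M.
  rewrite /M -lerBlDl (le_trans (lerB_dist _ _)) // distrC fe //.
  by apply: le_lt_trans (pd _ xd') _; rewrite ltr_pdivrMr // ltr_pMr // ltr1n.
rewrite fx normrM normfV ler_pdivrMr ?normr_gt0 //; apply/negP; rewrite -ltNge.
have sx : `|peval s y| / 2 <= `|peval s x|.
  have := sd x xd'; rewrite distrC => /(le_trans (lerB_dist _ _)).
  by rewrite -/(peval s x) -/(peval s y); lra.
apply: lt_le_trans sx; have := bd x xd'; rewrite -/(peval b x) -/(peval b y) b0 subr0.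
rewrite ler_pdivlMr ?ltr_wpDl ?(ltW M0) //; apply: lt_le_trans.
by rewrite mulrC ltr_pM2l ?normr_gt0 // ltrDl.
Qed.

Lemma integral_regular g : integralOver (\val : K0Cent X -> ratfun X) (iota g) ->
  g \in regular_functions X'.
Proof.
move=> [p pm /eqP]; rewrite horner_coef size_map_poly_id0; last first.
  by rewrite (monicP pm) rmorph1 oner_neq0.
move=> pg; apply/regular_functionsP => y Yy.
have [i ut] := uniformizer_normalization curveX normX Yy.
have [//|gV] := valuation_ring Yy ut (dim_le1_normalization curveX normX) g.
have [->|g0] := eqVneq g 0; first by exists 0; exact: hasval0.
have /choice[c cE] : forall k, exists z, iota z = \val p`_k.
  by move=> k; exact: iota_surj normX _.
have /choice[v cv] : forall k, exists v, hasval y (c k) v.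
  by move=> k; apply: cont_rational_regular => //; rewrite cE; exact: (valP p`_k).
have : exists d, size p = d.+1.
  by exists (size p).-1; rewrite prednK // lt0n size_poly_eq0 monic_neq0.
move=> [d sp]; have cd : c d = 1.
  apply: (fmorph_inj iota); rewrite cE rmorph1.
  by move/monicP: pm; rewrite lead_coefE sp /= => ->.
have {}pg : \sum_(k < d.+1) c k * g ^+ k = 0.
  apply: (fmorph_inj iota); rewrite rmorph0 -pg rmorph_sum sp.
  by apply: eq_bigr => k _ /=; rewrite rmorphM rmorphXn /= cE coef_map_id0.
case: d => [|d] in sp cd pg *.
  by move/eqP: pg; rewrite big_ord1 cd expr0 mulr1 oner_eq0.
(* The equation divided by [g ^+ d]. Its right-hand side involves only the coefficients and [g^-1],
   all in the local ring at [y]. *)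
have gE : g = - \sum_(k < d.+1) c k * g^-1 ^+ (d - k).
  apply/eqP; rewrite -addr_eq0; apply/eqP; apply: (mulIf (expf_neq0 d g0)).
  rewrite mul0r mulrDl -exprS mulr_suml -[RHS]pg [RHS]big_ord_recr /= cd mul1r addrC.
  congr (_ + _); apply: eq_bigr => k _; rewrite -mulrA; congr (_ * _).
  have kd : (k <= d)%N by rewrite -ltnS.
  have -> : g ^+ d = g ^+ (d - k) * g ^+ k by rewrite -exprD subnK.
  by rewrite exprVn (mulKf (expf_neq0 _ g0)).
exists (- \sum_(k < d.+1) v k * 0 ^+ (d - k)); rewrite {1}gE.
apply: hasvalN => //; apply: hasval_sum => // k _; apply: hasvalM => //.
exact: hasvalX.
Qed.

End CentralLocus.
(** * Regular functions are integral *)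

Lemma root_map_sub_prod (A B : comNzRingType) (v : {rmorphism A -> B})
    (I : Type) (F : seq I) (u : I -> A) w z :
  z * \prod_(y <- F) (z - v (u y)) = v w ->
  root (map_poly v ('X * \prod_(y <- F) ('X - (u y)%:P) - w%:P)) z.
Proof.
move=> zE; rewrite rmorphB rmorphM rmorph_prod /= map_polyX map_polyC /root.
rewrite hornerD hornerN hornerC hornerM hornerX horner_prod subr_eq0.
apply/eqP; apply: etrans zE; congr (_ * _); apply: eq_bigr => y _.
by rewrite rmorphB /= map_polyX map_polyC hornerXsubC.
Qed.

Section Converse.
Variables (R : realType) (m n : nat) (X : irr_algset R n) (X' : irr_algset R m).
Variables (pi' : n.-tuple (mpoly m R)) (iota : {rmorphism ratfun X' -> ratfun X}).
Hypothesis curveX : is_curve X.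
Hypothesis normX : is_normalization pi' iota.

Lemma closed_irr_set : closed (irr_set X').
Proof.
have [S ->] := irr_algebraic X'.
rewrite (_ : [set x | _] = \bigcap_(p in S) (ev p @^-1` [set 0])).
  apply: closed_bigI => p _; apply: preimage_closed.
    by move=> x _; exact: continuous_ev.
  exact: closed_eq.
by apply/seteqP; split=> x h p /h.
Qed.

Lemma cont_rational_const r : frac (polyclass X (mpolyC n r)) \in cont_rational X.
Proof.
apply/asboolP; exists (cst r), (mpolyC n r), 1; split.
- exact: cst_continuous.
- exists (irr_set X); split=> //.
  + exists set0; last by rewrite setD0.
    exists [set 1]; apply/seteqP; split=> // y /(_ _ erefl)/eqP.
    by rewrite /ev meval1 oner_eq0.
  + by move=> x _; rewrite /ev meval1; apply/eqP; exact: oner_neq0.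
  + by move=> x _ _; rewrite /ev meval1 mevalC divr1.
- by rewrite polyclass1 tofrac1 divr1.
Qed.

Section Denominator.
Variables (c : polyfun X) (a : 'I_m -> polyfun X).
Hypothesis c0 : c != 0.
Hypothesis caE : forall j,
  frac c * iota (frac (polyclass X' (mpolyX R (mnm1 j)))) = frac (a j).
Local Notation psi := (section_map c a).

(** This is the properness of X' -> X: the coordinates of a lifted point are roots of monic
    polynomials over P(X), whose coefficients are bounded near [x0]. *)
Lemma section_bounded x0 : irr_set X x0 -> exists d B, [/\ 0 < d, 0 < B &
  forall x, irr_set X x -> `|x - x0| <= d -> peval c x != 0 -> `|psi x| <= B].
Proof.
move=> Xx0.
have bound j : exists B, 0 <= B /\ \forall d \near 0^'+, forall x, irr_set X x ->
    `|x - x0| <= d -> peval c x != 0 -> `|psi x ord0 j| <= B.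
  have [p pm /eqP] : integralOver (@FracField.tofrac (polyfun X))
      (iota (frac (polyclass X' (mpolyX R (mnm1 j))))).
    by apply/(integral_iota normX); exists (polyclass X' (mpolyX R (mnm1 j))).
  set z := iota _ => pz.
  have [d sp] : exists d, size p = d.+1.
    by exists (size p).-1; rewrite prednK // lt0n size_poly_eq0 monic_neq0.
  exists (1 + \sum_(k < d) (`|peval p`_k x0| + 1)); split.
    by rewrite addr_ge0 // sumr_ge0 // => k _; rewrite addr_ge0.
  have coefs : \forall e \near 0^'+, forall (k : 'I_d) x, `|x - x0| <= e ->
      `|peval p`_k x - peval p`_k x0| <= 1.
    apply: filter_forall => k; apply: lipschitz_near_cont => //.
    exact: lipschitz_near_ev.
  apply: filterS coefs => e he x Xx xe cx.
  have xz : hasval x z (psi x ord0 j).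
    have := hasval_iota_poly normX c0 caE Xx cx (mpolyX R (mnm1 j)).
    by rewrite /ev mevalXU.
  have : `|psi x ord0 j| <= 1 + \sum_(k < d) `|peval p`_k x|.
    apply: (monic_root_bound (c := fun k => peval p`_k x)).
      by move/monicP: pm; rewrite lead_coefE sp /= => ->; rewrite peval1.
    apply: (hasval_inj Xx (z := 0)); last exact: hasval0.
    rewrite -pz horner_coef size_map_poly_id0; last first.
      by rewrite (monicP pm) tofrac1 oner_neq0.
    rewrite sp; apply: hasval_sum => // k _; rewrite coef_map /=.
    by apply: hasvalM => //; [exact: hasval_frac | exact: hasvalX].
  move=> /le_trans; apply; rewrite lerD2l; apply: ler_sum => k _.
  by rewrite -lerBlDl (le_trans (lerB_dist _ _)) // he.
have [B BP] := choice bound.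
have [d [d0 dP]] := near_right_ex (filter_forall _ (fun j => (BP j).2)).
have sB : 0 <= \sum_j B j by apply: sumr_ge0 => j _; case: (BP j).
exists d, (1 + \sum_j B j); split=> //; first by rewrite ltr_pwDl.
move=> x Xx xd cx; apply: norm_le_coord => [|j]; first by rewrite addr_ge0.
apply: le_trans (dP j x Xx xd cx) _; rewrite (bigD1 j) //= addrCA lerDl.
by rewrite addr_ge0 // sumr_ge0 // => i _; case: (BP i).
Qed.

Lemma lipschitz_near_section x0 (p : mpoly m R) : peval c x0 != 0 ->
  lipschitz_near x0 (fun x => ev p (psi x)).
Proof.
move=> cx0; elim/mpoly_ring_ind: p => [r|j|p q hp hq|p q hp hq].
- rewrite (_ : (fun _ => _) = fun=> r); first exact: lipschitz_near_cst.
  by apply/funext => x; rewrite /ev mevalC.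
- rewrite (_ : (fun _ => _) = fun x => peval (a j) x * (peval c x)^-1).
    apply: lipschitz_nearM; first exact: lipschitz_near_ev.
    by apply: lipschitz_nearV => //; exact: lipschitz_near_ev.
  by apply/funext => x; rewrite /ev mevalXU mxE.
- rewrite (_ : (fun _ => _) = fun x => ev p (psi x) + ev q (psi x)).
    exact: lipschitz_nearD.
  by apply/funext => x; rewrite /ev mevalD.
- rewrite (_ : (fun _ => _) = fun x => ev p (psi x) * ev q (psi x)).
    exact: lipschitz_nearM.
  by apply/funext => x; rewrite /ev mevalM.
Qed.

(* The set of points of [X'] in a bounded region where the quotient is not
   small is compact, and it misses the fibre over [x0]; hence so does its image
   near [x0]. *)
Lemma small_near_fibre x0 (b s : polyfun X') e : irr_set X x0 -> 0 < e ->
  (forall y, irr_set X' y -> peval s y != 0) ->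
  (forall y, irr_set X' y -> polymap pi' y = x0 -> peval b y = 0) ->
  exists2 d, 0 < d & forall x, irr_set X x -> `|x - x0| <= d -> peval c x != 0 ->
    `|peval b (psi x) / peval s (psi x)| <= e.
Proof.
move=> Xx0 e0 sY bY; have [d1 [B [d10 B0 psiB]]] := section_bounded Xx0.
(* [Q] is the squared distance from the image to [x0], and [P] below is its counterpart on X. The
   condition [T >= 0] says that |b / s| >= e. *)
pose Q : mpoly m R := \sum_i (tnth pi' i - mpolyC m (x0 ord0 i)) ^+ 2.
have QE y : ev Q y = \sum_i (polymap pi' y ord0 i - x0 ord0 i) ^+ 2.
  rewrite /ev raddf_sum; apply: eq_bigr => i _.
  by rewrite /= rmorphXn /= mevalB mevalC mxE.
pose T : mpoly m R := repr b ^+ 2 - mpolyC m (e ^+ 2) * repr s ^+ 2.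
have TE y : ev T y = peval b y ^+ 2 - e ^+ 2 * peval s y ^+ 2.
  by rewrite /ev mevalB [X in _ - X]mevalM mevalC !rmorphXn.
pose K : set 'rV[R]_m :=
  irr_set X' `&` closed_ball (0 : 'rV[R]_m) B `&` (ev T @^-1` [set r | 0 <= r]).
have cK : compact K.
  apply: bounded_closed_compact; last first.
    apply: closedI; first apply: closedI.
    - exact: closed_irr_set.
    - exact: closed_ball_closed.
    - apply: preimage_closed; last exact: closed_ge.
      by move=> x _; exact: continuous_ev.
  exists B; split=> [|M BM y [[_ yB] _]]; first exact: num_real.
  rewrite closed_ballE // /closed_ball_ /= sub0r normrN in yB.
  exact: le_trans yB (ltW BM).
have big y x : irr_set X' y -> `|y| <= B -> ~ K y ->
    `|peval b y / peval s y| <= e.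
  move=> Yy yB nKy; have sy := sY y Yy.
  rewrite normrM normfV ler_pdivrMr ?normr_gt0 //.
  rewrite -(ler_pXn2r (n := 2)) ?nnegrE ?mulr_ge0 ?(ltW e0) //.
  rewrite exprMn !real_normK ?num_real // -subr_le0 -TE leNgt.
  apply/negP => T0; apply: nKy; split; last exact: ltW.
  by split=> //; rewrite closed_ballE // /closed_ball_ /= sub0r normrN.
have [q0 [q00 qK]] : exists q0, 0 < q0 /\ forall y, K y -> q0 <= ev Q y.
  have [K0|nK] := pselect (K !=set0); last first.
    by exists 1; split=> // y Ky; case: nK; exists y.
  have [|y /set_mem Ky minQ] := EVT_min_rV (f := ev Q) K0 cK.
    by apply: continuous_subspaceT; exact: continuous_ev.
  exists (ev Q y); split; last by move=> z Kz; apply: minQ; exact: mem_set.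
  have [[Yy _] Ty] := Ky.
  have Q0 : 0 <= ev Q y by rewrite QE sumr_ge0 // => i _; exact: sqr_ge0.
  rewrite lt_neqAle Q0 andbT; apply/eqP => /esym Qy0.
  have piy : polymap pi' y = x0.
    apply/rowP => i; apply/eqP; rewrite -subr_eq0 -sqrf_eq0.
    move/eqP: Qy0; rewrite QE psumr_eq0 => [/allP/(_ i)|j _]; last exact: sqr_ge0.
    by rewrite mem_index_enum => /(_ isT).
  have := Ty; rewrite /= TE bY // expr0n sub0r oppr_ge0 leNgt => /negP; apply.
  by apply: mulr_gt0; rewrite exprn_even_gt0 //=; [exact: lt0r_neq0 | exact: sY].
pose P : mpoly n R := \sum_i (mpolyX R (mnm1 i) - mpolyC n (x0 ord0 i)) ^+ 2.
have PE x : ev P x = \sum_i (x ord0 i - x0 ord0 i) ^+ 2.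
  rewrite /ev raddf_sum; apply: eq_bigr => i _.
  by rewrite /= rmorphXn /= mevalB mevalC mevalXU.
have Px0 : ev P x0 = 0 by rewrite PE big1 // => i _; rewrite subrr expr0n.
have q20 : 0 < q0 / 2 by rewrite divr_gt0.
have [d2 [d20 Pd]] := near_right_ex (lipschitz_near_cont (lipschitz_near_ev x0 P) q20).
exists (Num.min d1 d2); first by rewrite lt_min d10.
move=> x Xx; rewrite le_min => /andP[xd1 xd2] cx.
have Yx := section_in normX c0 caE Xx cx.
apply: big => //; first exact: psiB.
move=> /qK; rewrite QE (polymap_section normX c0 caE Xx cx) -PE leNgt => /negP; apply.
have := Pd x xd2; rewrite Px0 subr0 => /(le_trans (ler_norm _)) /le_lt_trans; apply.
by rewrite ltr_pdivrMr // ltr_pMr // ltr1n.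
Qed.

Lemma cont_rational_of_vanishing g (W : 'rV[R]_m -> R) :
  (forall y, irr_set X' y -> hasval y g (W y)) ->
  (forall y, irr_set X' y -> peval c (polymap pi' y) = 0 -> W y = 0) ->
  iota g \in cont_rational X.
Proof.
move=> gW W0.
have /localizationP[b [s [/asboolP sY gE]]] : g \in regular_functions X'.
  by apply/regular_functionsP => y Yy; exists (W y); exact: gW.
have {}sY y : irr_set X' y -> peval s y != 0 by move=> Yy; apply/eqP; exact: sY.
have WE y : irr_set X' y -> W y = peval b y / peval s y.
  move=> Yy; apply: (hasval_inj Yy (gW y Yy)); exists b, s; split=> //.
  exact: sY.
have bY x0 : irr_set X x0 -> peval c x0 = 0 ->
    forall y, irr_set X' y -> polymap pi' y = x0 -> peval b y = 0.
  move=> Xx0 cx0 y Yy yx0; apply/eqP; have := W0 y Yy; rewrite yx0 => /(_ cx0)/eqP.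
  by rewrite WE // mulf_eq0 invr_eq0 (negPf (sY y Yy)) orbF.
have [A [D [D0 zE]]] := fraction_rep (iota g).
pose f x := if peval c x == 0 then 0 else peval b (psi x) / peval s (psi x).
(* Off the zeros of [D * c] both the quotient [A / D] and the lift [psi] make sense, and there [f]
   equals [A / D]. *)
have [oU dU] := zariski_open_dense (mulf_neq0 D0 c0).
apply/asboolP; exists f, (repr A), (repr D); split; last by rewrite !polyclass_repr.
  apply/subspace_continuousP => x0 [Xx0 Cx0].
  apply: (@cvgrPdist_le _ _ _ _ _ f (f x0)).2 => e e0; rewrite near_withinE.
  apply/nbhs_rV_normP.
  have [cx0|cx0] := eqVneq (peval c x0) 0.
    have [d d0 dP] := small_near_fibre Xx0 e0 sY (bY x0 Xx0 cx0).
    exists d => // x xd [Xx _]; rewrite /f cx0 eqxx sub0r normrN.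
    by case: eqVneq => cx; [rewrite normr0 ltW | apply: dP => //; exact: ltW].
  have cxh : 0 < `|peval c x0| / 2 by rewrite divr_gt0 // normr_gt0.
  have lf : lipschitz_near x0 (fun x => ev (repr b) (psi x) / ev (repr s) (psi x)).
    apply: lipschitz_nearM; first exact: lipschitz_near_section.
    apply: lipschitz_nearV; first exact: lipschitz_near_section.
    exact: sY (section_in normX c0 caE Xx0 cx0).
  have [d [d0 [cd fd]]] := near_right_ex (filterI
    (lipschitz_near_cont (lipschitz_near_ev x0 (repr c)) cxh) (lipschitz_near_cont lf e0)).
  exists d => // x xd [Xx _]; have xd' := ltW xd.
  have cx : peval c x != 0.
    have := cd x xd'; apply: contraTneq => cx.
    rewrite -/(peval c x) cx sub0r normrN -ltNge -/(peval c x0).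
    by rewrite ltr_pdivrMr // ltr_pMr ?normr_gt0 // ltr1n.
  by rewrite /f (negPf cx0) (negPf cx) distrC; exact: fd.
exists (irr_set X `\` [set x | ev (repr (D * c)) x = 0]).
have nz x : (irr_set X `\` [set x | ev (repr (D * c)) x = 0]) x ->
    [/\ irr_set X x, peval D x != 0 & peval c x != 0].
  move=> [Xx /eqP]; rewrite -/(peval (D * c) x) pevalM // mulf_eq0 negb_or.
  by case/andP.
split=> // [x /nz[_ Dx _]|x /nz[Xx Dx cx] _]; first exact/eqP.
rewrite /f (negPf cx).
have Yx := section_in normX c0 caE Xx cx.
apply: (hasval_inj Xx (z := iota g)); last by exists A, D.
rewrite gE fmorph_div; apply: hasvalM => //; first exact: (hasval_iota normX).
by apply: hasvalV; [exact: (hasval_iota normX) | exact: sY].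
Qed.

End Denominator.

Definition K0_elt z (zK : z \in cont_rational X) : K0Cent X :=
  exist (fun z => z \in cont_rational X) z zK.

(* [g] is a root of a monic real polynomial up to a function vanishing over the
   zeros of the denominator; such a function extends continuously by zero. *)
Lemma regular_integral g : g \in regular_functions X' ->
  integralOver (\val : K0Cent X -> ratfun X) (iota g).
Proof.
move=> /regular_functionsP gY.
have [c [a [c0 caE]]] := exists_denominator iota.
have pc0 : pullback X' pi' c != 0 by rewrite (pullback_eq0 normX).
have /finite_seqP[F FE] := zero_set_finite (dim_le1_normalization curveX normX) pc0.
have /choice[G GP] : forall y, exists v, irr_set X' y -> hasval y g v.
  move=> y; have [Yy|nYy] := pselect (irr_set X' y); last by exists 0.
  by have [v gv] := gY y Yy; exists v.
pose k (r : R) : K0Cent X := K0_elt (cont_rational_const r).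
(* The extra factor [g], matched by ['X] in [p], keeps the degree positive even when [F] is empty,
   so that subtracting the constant [iota w] leaves the polynomial monic. *)
pose w := g * \prod_(y <- F) (g - frac (polyclass X' (mpolyC m (G y)))).
have hasval_const y r : irr_set X' y -> hasval y (frac (polyclass X' (mpolyC m r))) r.
  move=> Yy; have := hasval_frac Yy (polyclass X' (mpolyC m r)).
  by rewrite peval_polyclass // /ev mevalC.
have wK : iota w \in cont_rational X.
  apply: (cont_rational_of_vanishing c0 caE
    (W := fun y => G y * \prod_(z <- F) (G y - G z))) => y Yy.
    apply: hasvalM => //; first exact: GP.
    elim: F {FE w} => [|z F IHF]; first by rewrite !big_nil; exact: hasval1.
    rewrite !big_cons; apply: hasvalM => //; apply: hasvalD => //; first exact: GP.
    by apply: hasvalN => //; exact: hasval_const.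
  move=> cy; have yF : y \in F.
    have : [set` F] y by rewrite -FE; split=> //; rewrite peval_pullback.
    by [].
  by rewrite (big_rem y) //= subrr mul0r mulr0.
pose p : {poly K0Cent X} := 'X * \prod_(y <- F) ('X - (k (G y))%:P).
have pm : p \is monic by rewrite rpredM ?monicX // monic_prod_XsubC.
exists (p - (K0_elt wK)%:P).
  rewrite monicE lead_coefDl; first exact: pm.
  rewrite size_polyN (leq_ltn_trans (size_polyC_leq1 _)) //.
  by rewrite /p mulrC size_mulX ?monic_neq0 ?monic_prod_XsubC // size_prod_XsubC.
pose v : {rmorphism K0Cent X -> ratfun X} := \val.
apply: (root_map_sub_prod (v := v)).
rewrite -[RHS]/(iota w) /w rmorphM rmorph_prod; congr (_ * _).
by apply: eq_bigr => y _; rewrite rmorphB (iota_const normX).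
Qed.

End Converse.

Theorem theorem5p15 (R : realType) (m n : nat)
    (X : irr_algset R n) (X' : irr_algset R m)
    (pi' : n.-tuple (mpoly m R)) (iota : {rmorphism ratfun X' -> ratfun X}) :
  is_curve X -> is_normalization pi' iota ->
  [set z : ratfun X | integralOver (\val : K0Cent X -> ratfun X) z] =
  iota @` [set g : ratfun X' | g \in regular_functions X'].
Proof.
move=> curveX normX; apply/seteqP; split=> [z|_ [g gY <-]] /=.
  have [g <-] := iota_surj normX z => gint.
  by exists g => //; exact: (integral_regular curveX normX gint).
exact: (regular_integral curveX normX gY).
Qed.
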